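(* Let $n\ge1$, $s\in(0,1)$, $\varepsilon>0$, and let $u\in C^\infty_c(\mathbb{R}^n)$ satisfy $(-\Delta)^su=f$ in $\mathbb{R}^n$, where $f\in C^{s+\varepsilon}_{loc}(\mathbb{R}^n)\cap L^1_{s/2}(\mathbb{R}^n)$ and $\langle\nabla^s u,\nabla^s f\rangle\le0$ in a neighborhood of the origin. Then there exists $R_0>0$ such that the map $R\mapsto\mathfrak{J}^s_{ACF}(u,R)$ is monotone nondecreasing on $(0,R_0)$.
   Context: $B_r$ is the open ball of radius $r$ centered at $0$; $\langle\cdot,\cdot\rangle$ is the Euclidean inner product. $C_{n,s}:=\left(\int_{\mathbb{R}^n}\frac{1-\cos(\zeta_1)}{|\zeta|^{n+2s}}d\zeta\right)^{-1}$ and $(-\Delta)^s u(x):=C_{n,s}\lim_{\epsilon\to0}\int_{\mathbb{R}^n\setminus B_\epsilon(x)}\frac{u(x)-u(y)}{|x-y|^{n+2s}}dy$. For $t\in(0,1)$, $L^1_t(\mathbb{R}^n):=\{u\in L^1_{loc}:\int\frac{|u(x)|}{1+|x|^{n+2t}}dx<\infty\}$. For $\gamma>0$ not an integer, $C^{\gamma}_{loc}$ denotes $C^{k,\gamma-k}_{loc}$ with $k=\lfloor\gamma\rfloor$. With $\mu_{n,s}:=2^s\pi^{-n/2}\frac{\Gamma((n+s+1)/2)}{\Gamma((1-s)/2)}$, $\partial^s_i u(x):=\mu_{n,s}\int_{\mathbb{R}^n}\frac{(y_i-x_i)(u(y)-u(x))}{|y-x|^{n+s+1}}dy$, $\nabla^s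 u:=(\partial^s_1u,\dots,\partial^s_nu)$, $|\nabla^s u|$ its Euclidean norm. With $a_{n,s}:=\Gamma(n/2)\pi^{-n/2-1}\sin(\pi s)$, $K^s_r(0,y):=a_{n,s}\left(\frac{r^2}{|y|^2-r^2}\right)^s\frac{1}{|y|^n}$ for $|y|>r$, and $\mathfrak{J}^s_{ACF}(u,R):=\frac{1}{R^{1+s}}\int_0^R r^s\int_{\mathbb{R}^n\setminus B_r}K^s_r(0,y)|\nabla^s u(y)|^2\,dy\,dr$. *)

(* Defs.v *)
From HB Require Import structures.
From mathcomp Require Import all_boot all_order all_algebra.
From mathcomp Require Import all_classical all_reals all_analysis.

Set Implicit Arguments.
Unset Strict Implicit.
Unset Printing Implicit Defensive.

Import Order.TTheory GRing.Theory Num.Theory.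
Import numFieldNormedType.Exports.

Local Open Scope classical_set_scope.
Local Open Scope ring_scope.

Section Defs.
Variable R : realType.

Definition enorm (n : nat) (x : 'rV[R]_n) : R :=
  Num.sqrt (\sum_(i < n) (x ord0 i) ^+ 2).

Definition edot (n : nat) (x y : 'rV[R]_n) : R :=
  \sum_(i < n) x ord0 i * y ord0 i.

(* Integration over R^n w.r.t. n-dimensional Lebesgue measure, written as
   the iterated one-dimensional Lebesgue integral (Fubini/Tonelli):
   iint k F x integrates successively the coordinates k-1, ..., 0. *)
Fixpoint iint (k : nat) (F : (nat -> R) -> \bar R) (x : nat -> R) : \bar R :=
  match k with
  | 0 => F x
  | k'.+1 => (\int[@lebesgue_measure R]_t
                 iint k' F (fun j => if j == k' then t else x j))%E
  end.

Definition intRn (n : nat) (g : 'rV[R]_n -> \bar R) : \bar R :=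
  iint n (fun x => g (\row_(i < n) x i)) (fun _ => 0).

Definition Gamma (z : R) : R :=
  fine (\int[@lebesgue_measure R]_(t in `]0%R, +oo[)
          ((powR t (z - 1)) * expR (- t))%:E)%E.

Definition Cns (n : nat) (s : R) : R :=
  (fine (iint n (fun z => ((1 - cos (z 0%N)) /
            powR (enorm (\row_(i < n) z i)) (n%:R + 2 * s))%:E)
          (fun _ => 0)))^-1.

Definition frac_lap_trunc (n : nat) (s : R) (u : 'rV[R]_n -> R)
    (eps : R) (x : 'rV[R]_n) : \bar R :=
  intRn (fun y => if eps <= enorm (x - y)
                  then ((u x - u y) / powR (enorm (x - y)) (n%:R + 2 * s))%:E
                  else 0%E).

Definition frac_lap (n : nat) (s : R) (u : 'rV[R]_n -> R) (x : 'rV[R]_n) : R :=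
  Cns n s * lim ((fun eps => fine (frac_lap_trunc s u eps x)) @ 0^'+).

Definition L1_loc (n : nat) (u : 'rV[R]_n -> R) : Prop :=
  forall r : R, 0 < r ->
    (intRn (fun x => if (enorm x < r)%R then (`|u x|)%:E else 0%E) < +oo)%E.

Definition L1_weighted (n : nat) (t : R) (u : 'rV[R]_n -> R) : Prop :=
  L1_loc u /\
  (intRn (fun x => (`|u x| / (1 + powR (enorm x) (n%:R + 2 * t)))%:E) < +oo)%E.

Definition ebasis (n : nat) (i : 'I_n) : 'rV[R]_n := delta_mx ord0 i.

Definition partial (n : nat) (i : 'I_n) (f : 'rV[R]_n -> R) : 'rV[R]_n -> R :=
  fun x => 'D_(ebasis i) f x.

Definition Dseq (n : nat) (l : seq 'I_n) (f : 'rV[R]_n -> R) : 'rV[R]_n -> R :=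
  foldr (@partial n) f l.

Definition Ck (n : nat) (k : nat) (f : 'rV[R]_n -> R) : Prop :=
  (forall (l : seq 'I_n) (i : 'I_n) (x : 'rV[R]_n),
      (size l < k)%N -> derivable (Dseq l f) x (ebasis i)) /\
  (forall l : seq 'I_n, (size l <= k)%N -> continuous (Dseq l f)).

Definition smooth (n : nat) (f : 'rV[R]_n -> R) : Prop :=
  forall k, Ck k f.

Definition smooth_compact (n : nat) (f : 'rV[R]_n -> R) : Prop :=
  smooth f /\ exists M : R, forall x, M < enorm x -> f x = 0.

Definition Holder_loc (n : nat) (gamma : R) (f : 'rV[R]_n -> R) : Prop :=
  let k := Num.truncn gamma in
  let alpha := gamma - k%:R in
  Ck k f /\
  forall l : seq 'I_n, size l = k ->
    forall r : R, 0 < r -> exists C : R, forall x y : 'rV[R]_n,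
      enorm x < r -> enorm y < r ->
      `|Dseq l f x - Dseq l f y| <= C * powR (enorm (x - y)) alpha.

Definition mu_ns (n : nat) (s : R) : R :=
  powR 2 s * powR pi (- (n%:R / 2)) *
  Gamma ((n%:R + s + 1) / 2) / Gamma ((1 - s) / 2).

Definition frac_partial (n : nat) (s : R) (u : 'rV[R]_n -> R) (i : 'I_n)
    (x : 'rV[R]_n) : R :=
  mu_ns n s * fine (intRn (fun y =>
     ((y ord0 i - x ord0 i) * (u y - u x) /
        powR (enorm (y - x)) (n%:R + s + 1))%:E)).

Definition frac_grad (n : nat) (s : R) (u : 'rV[R]_n -> R) (x : 'rV[R]_n)
  : 'rV[R]_n := \row_(i < n) frac_partial s u i x.

Definition a_ns (n : nat) (s : R) : R :=
  Gamma (n%:R / 2) * powR pi (- (n%:R / 2) - 1) * sin (pi * s).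

(* K^s_r(0,y), for |y| > r *)
Definition Kernel (n : nat) (s r : R) (y : 'rV[R]_n) : R :=
  a_ns n s * powR (r ^+ 2 / (enorm y ^+ 2 - r ^+ 2)) s / enorm y ^+ n.

Definition J_ACF (n : nat) (s : R) (u : 'rV[R]_n -> R) (Rad : R) : \bar R :=
  ((powR Rad (- 1 - s))%:E *
   \int[@lebesgue_measure R]_(r in `]0%R, Rad[)
      ((powR r s)%:E *
       intRn (fun y => if (r < enorm y)%R
                       then (Kernel s r y * enorm (frac_grad s u y) ^+ 2)%:E
                       else 0%E)))%E.

End Defs.

(* Main.v *)
(* Write G for the fractional gradient of u and nu(z) = |z|^(-n-2s).  Up to the
   factor a_{n,s}, the inner integral of the functional is
     M(r) = r^(2s) int_{|z|>r} (|z|^2 - r^2)^(-s) |z|^(-n) |G(z)|^2 dz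
          = A |G(0)|^2 + r^(2s) (N + O(r^(1-s))),
   where N = int nu(z) ((|G(z)|^2 + |G(-z)|^2) / 2 - |G(0)|^2) dz.  Expanding the
   squares, N is the sum of int nu(z) |G(z) - G(0)|^2 dz and of a positive
   multiple of - <grad^s u, (-Delta)^s grad^s u>(0).  As (-Delta)^s and grad^s
   commute, the latter is nonnegative by the hypothesis at the origin.  Hence
   N >= 0.  If N = 0 then |G| is a.e. constant and so is M; if N > 0 then M(r) is
   so close to alpha + c r^(2s) with c > 0 near 0 that its weighted mean
   increases.  Since the radius R_0 is free, only the origin is needed. *)
Require Import Defs.
From HB Require Import structures.
From mathcomp Require Import all_boot all_order all_algebra.
From mathcomp Require Import all_classical all_reals all_analysis.
From mathcomp Require Import measurable_realfun ring lra.

Set Implicit Arguments.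
Unset Strict Implicit.
Unset Printing Implicit Defensive.

Import Order.TTheory GRing.Theory Num.Theory.
Import numFieldNormedType.Exports.

Local Open Scope classical_set_scope.
Local Open Scope ring_scope.

(** * Iterated Lebesgue integrals *)

Section LebesgueAffine.
Context {R : realType}.
Local Notation leb := (@lebesgue_measure R).
Local Open Scope ereal_scope.

(** Integrals over R^n are given as iterated one-dimensional integrals, so a measure space realizing
    them has to be built before Fubini, domination and substitution can be used; [lebesgue_model]
    does this. Regularity of [u] enters the estimates only through finite differences: a difference
    of order k with increments a_1, ..., a_k is at most a constant times the product of the min(1,
    |a_j|). One such factor tames the kernel of the fractional gradient, two tame that of the
    fractional Laplacian, and in both cases the same function [domin] is an integrable majorant;
    differences up to order three thus justify exchanging the two operators. The averaging supplies
    the missing room: with weight t^s, the function t^(2s) on (0, r) has mean (1 + s) / (1 + 3s)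
    times its value at r, a factor below 1. It is therefore enough to squeeze M between alpha + l
    r^(2s) and alpha + U r^(2s) with U (1 + s) at most l (1 + 3s). *)

Definition affineR (c b : R) : measurableTypeR R -> measurableTypeR R :=
  fun t => (c * t + b)%R.

Lemma measurable_affineR (c b : R) : measurable_fun [set: measurableTypeR R] (affineR c b).
Proof. by apply: measurable_funD => //; apply: measurable_funM. Qed.

(** By uniqueness of the measure giving half-open intervals their length: the pushforward scaled by
    [|c|] has this property. For [c < 0] the preimage is closed at the other end, which leaves its
    length unchanged. *)
Lemma lebesgue_measure_affine (c b : R) (A : set R) : (c != 0)%R ->
  measurable A -> `|c|%:E * leb (affineR c b @^-1` A) = leb A.
Proof.
move=> c0 mA; apply/esym.
apply: (lebesgue_measure_unique (mu := mscale (NngNum (normr_ge0 c)) (pushforward leb (affineR c b)))) => //.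
  exact: measurable_affineR.
move=> mphi _ [[x y]] _ <-.
rewrite -[RHS]/(`|c|%:E * leb (affineR c b @^-1` `]x, y])).
have [c1|c1] := ltP 0%R c.
  rewrite (_ : affineR c b @^-1` _ = `]((x - b) / c)%R, ((y - b) / c)%R]%classic); last first.
    by apply/seteqP; split=> t /=; rewrite !in_itv/= /affineR ltr_pdivrMr// ler_pdivlMr// ltrBlDr lerBrDr mulrC.
  rewrite !lebesgue_measure_itv/= !lte_fin ltr_pM2r ?invr_gt0// ltrD2r.
  case: ifP => _; last by rewrite mule0.
  by rewrite -!EFinB -EFinM (gtr0_norm c1); congr EFin; field.
have {}c1 : (c < 0)%R by rewrite lt_neqAle c0.
rewrite (_ : affineR c b @^-1` _ = `[((y - b) / c)%R, ((x - b) / c)%R[%classic); last first.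
  by apply/seteqP; split=> t /=; rewrite !in_itv/= /affineR ler_ndivrMr// ltr_ndivlMr// ltrBlDr lerBrDr mulrC andbC.
rewrite !lebesgue_measure_itv/= !lte_fin ltr_nM2r ?invr_lt0// ltrD2r.
case: ifP => _; last by rewrite mule0.
by rewrite -!EFinB -EFinM (ltr0_norm c1); congr EFin; field.
Qed.

Lemma ge0_integral_affine (c b : R) (f : R -> \bar R) : (c != 0)%R ->
  measurable_fun [set: R] f -> (forall x, 0 <= f x) ->
  `|c|%:E * \int[leb]_t f (c * t + b)%R = \int[leb]_t f t.
Proof.
move=> c0 mf f0.
have := @ge0_integral_pushforward _ _ _ _ _ _ (measurable_affineR c b) leb setT f measurableT mf (fun x _ => f0 x).
rewrite preimage_setT => /= <-.
rewrite [RHS](eq_measure_integral (mscale (NngNum (normr_ge0 c)) (pushforward leb (affineR c b)))) //.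
- exact: measurable_affineR.
- by move=> mphi; rewrite ge0_integral_mscale.
- by move=> ? A mA _; apply/esym; exact: lebesgue_measure_affine.
Qed.

End LebesgueAffine.

(* The library's product measure has no canonical sigma-finite structure on
   general sigma-finite factors, hence this alias. *)
Section SigmaFiniteProduct.
Context d1 d2 (T1 : measurableType d1) (T2 : measurableType d2) (R : realType).
Variables (m1 : {sigma_finite_measure set T1 -> \bar R})
  (m2 : {sigma_finite_measure set T2 -> \bar R}).
Local Open Scope ereal_scope.

Definition sprod : set (T1 * T2) -> \bar R := m1 \x m2.

HB.instance Definition _ := Measure.on sprod.

Let sprod_sigma_finite : sigma_finite setT sprod.
Proof.
have /sigma_finiteP[F [TF F_nd mF]] := sigma_finiteT m1.
have /sigma_finiteP[G [TG G_nd mG]] := sigma_finiteT m2.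
exists (fun i => F i `*` G i) => [|i].
  apply/seteqP; split=> // -[x y] _.
  have: [set: T1] x by []. rewrite TF => -[i _ Fx].
  have: [set: T2] y by []. rewrite TG => -[j _ Gy].
  exists (maxn i j) => //; split=> /=.
    by move/subsetPset: (F_nd _ _ (leq_maxl i j)); apply.
  by move/subsetPset: (G_nd _ _ (leq_maxr i j)); apply.
have [mFi Fi] := mF i; have [mGi Gi] := mG i.
split; first exact: measurableX.
by rewrite /sprod product_measure1E// lte_mul_pinfty// ge0_fin_numE.
Qed.
HB.instance Definition _ := Measure_isSigmaFinite.Build _ _ _ sprod sprod_sigma_finite.

End SigmaFiniteProduct.

(** * Iterated integrals as integrals over a measure space *)

Section IteratedIntegral.
Context {R : realType}.
Local Notation leb := (@lebesgue_measure R).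
Local Open Scope ereal_scope.

Definition upd (x : nat -> R) (k : nat) (t : R) : nat -> R :=
  fun j => if j == k then t else x j.

(* Borel measurability of a function of countably many coordinates, expressed
   without naming a sigma-algebra on the source: composing with measurable
   coordinates gives a measurable function. *)
Definition borel_coord (F : (nat -> R) -> \bar R) :=
  forall d (S : measurableType d) (c : S -> nat -> R),
    (forall j, measurable_fun setT (c ^~ j)) -> measurable_fun setT (F \o c).

(** Tonelli gives measurability for nonnegative integrands; splitting into positive and negative
    parts extends it to all measurable [f], integrable or not. *)
Lemma measurable_integral_param d1 d2 (T1 : measurableType d1) (T2 : measurableType d2)
    (m2 : {sigma_finite_measure set T2 -> \bar R}) (f : T1 -> T2 -> \bar R) :
  measurable_fun setT (fun z : T1 * T2 => f z.1 z.2) ->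
  measurable_fun setT (fun x => \int[m2]_y f x y).
Proof.
move=> mf; pose g z := f z.1 z.2.
rewrite (_ : (fun _ => _) = fun x => \int[m2]_y g^\+ (x, y) - \int[m2]_y g^\- (x, y)); last first.
  by apply/funext => x; rewrite [LHS]integralE; congr (_ - _); apply: eq_integral => y _; rewrite !(funeposE, funenegE).
apply: emeasurable_funB.
  by apply: (measurable_fun_fubini_tonelli_F g^\+) => //; exact: measurable_funepos.
by apply: (measurable_fun_fubini_tonelli_F g^\-) => //; exact: measurable_funeneg.
Qed.

Lemma measurable_upd d (S : measurableType d) (c : S -> nat -> R) (g : S -> R) k :
  (forall j, measurable_fun setT (c ^~ j)) -> measurable_fun setT g ->
  forall j, measurable_fun setT (fun s => upd (c s) k (g s) j).
Proof. by move=> mc mg j; rewrite /upd; case: eqP. Qed.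

(** Each integration enlarges the source from [S] to [S * R]; the induction goes through because
    [borel_coord] quantifies over all sources. *)
Lemma borel_iint k (F : (nat -> R) -> \bar R) : borel_coord F -> borel_coord (iint k F).
Proof.
elim: k F => [//|k IH] F bF d S c mc.
apply: (@measurable_integral_param _ _ _ _ leb (fun s t => iint k F (upd (c s) k t))).
apply: (IH F bF _ _ (fun z => upd (c z.1) k z.2)) => j.
apply: measurable_upd => //.
by move=> i; apply: (measurableT_comp (mc i)).
Qed.

Lemma borel_upd k (F : (nat -> R) -> \bar R) (x : nat -> R) : borel_coord F ->
  measurable_fun setT (fun t => F (upd x k t)).
Proof.
move=> bF; apply: (bF _ _ (fun t : R => upd x k t)) => j.
exact: measurable_upd.
Qed.

Lemma iint_ge0 k (F : (nat -> R) -> \bar R) x : (forall x, 0 <= F x) -> 0 <= iint k F x.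
Proof. by move=> F0; elim: k x => //= k IH x; apply: integral_ge0. Qed.

Definition affine_coord (c : R) (b x : nat -> R) : nat -> R := fun j => (c * x j + b j)%R.

Lemma borel_affine (F : (nat -> R) -> \bar R) (c : R) (b : nat -> R) : borel_coord F ->
  borel_coord (F \o affine_coord c b).
Proof.
move=> bF d S e me; apply: (bF _ _ (fun s => affine_coord c b (e s))) => j.
by apply: measurable_funD => //; apply: measurable_funM.
Qed.

(** One substitution per coordinate, each contributing a factor [|c|]. *)
Lemma iint_affine k (F : (nat -> R) -> \bar R) (c : R) (b x : nat -> R) : (c != 0)%R ->
  borel_coord F -> (forall x, 0 <= F x) ->
  (`|c| ^+ k)%:E * iint k (F \o affine_coord c b) x = iint k F (affine_coord c b x).
Proof.
move=> c0 bF F0; elim: k x => [|k IH] x.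
  by rewrite expr0 mul1e.
rewrite exprS EFinM/= -muleA -ge0_integralZl//; last 2 first.
- exact: (borel_upd k x (borel_iint k (borel_affine c b bF))).
- by move=> t _; apply: iint_ge0 => y /=.
under eq_integral do rewrite IH.
rewrite -[RHS](@ge0_integral_affine _ c (b k) (fun t => iint k F (upd (affine_coord c b x) k t))) //.
- congr (_ * _); apply: eq_integral => t _; congr (iint k F _).
  by apply/funext => j; rewrite /affine_coord /upd; case: eqP => // ->.
- exact: (borel_upd k _ (borel_iint k bF)).
- by move=> t; apply: iint_ge0.
Qed.

Definition merge (k : nat) (y x : nat -> R) : nat -> R :=
  fun j => if (j < k)%N then y j else x j.

(** R^k as a measure space whose carrier is left abstract, with [lm_e] as coordinates, so that the
    theorems on product measures apply to [iint]. [lm_null] discards coordinate hyperplanes;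
    [lm_prod] reduces integrals of products over the coordinates to dimension one. *)
Record leb_model (k : nat) := LebModel {
  lm_disp : measure_display;
  lm_T : measurableType lm_disp;
  lm_mu : {sigma_finite_measure set lm_T -> \bar R};
  lm_e : lm_T -> nat -> R;
  lm_meas : forall j, measurable_fun setT (lm_e ^~ j);
  lm_null : forall j, (j < k)%N -> lm_mu [set t | lm_e t j = 0%R] = 0;
  lm_ge0 : forall F : (nat -> R) -> \bar R, borel_coord F -> (forall x, 0 <= F x) ->
    forall x, iint k F x = \int[lm_mu]_t F (merge k (lm_e t) x);
  lm_int : forall F : (nat -> R) -> \bar R, borel_coord F -> forall x,
    lm_mu.-integrable setT (fun t => F (merge k (lm_e t) x)) ->
    iint k F x = \int[lm_mu]_t F (merge k (lm_e t) x);
  lm_prod : forall phi : R -> R, measurable_fun setT phi -> (forall t, 0 <= phi t)%R ->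
    \int[lm_mu]_t (\prod_(j < k) phi (lm_e t j))%:E = (\int[leb]_t (phi t)%:E) ^+ k }.

Lemma measurable_merge d (S : measurableType d) (c : S -> nat -> R) x k :
  (forall j, measurable_fun setT (c ^~ j)) ->
  forall j, measurable_fun setT (fun s => merge k (c s) x j).
Proof. by move=> mc j; rewrite /merge; case: ltnP. Qed.

Lemma merge_upd k (y x : nat -> R) r :
  merge k.+1 (upd y k r) x = merge k y (upd x k r).
Proof.
apply/funext => j; rewrite /merge /upd ltnS leq_eqVlt.
by case: (ltngtP j k).
Qed.

Lemma leb_model0 : leb_model 0.
Proof.
apply: (@LebModel 0 _ unit (\d_tt) (fun _ _ => 0%R)) => //.
- by move=> F bF F0 x; rewrite integral_dirac//= diracT mul1e.
- by move=> F bF x _; rewrite integral_dirac//= diracT mul1e.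
- by move=> phi mphi phi0; rewrite integral_dirac//= diracT mul1e big_ord0.
Qed.

Lemma leb_modelS k : leb_model k -> leb_model k.+1.
Proof.
case=> d T mu e me null_e ge0_e int_e prod_e.
pose e1 (z : T * measurableTypeR R) := upd (e z.1) k z.2.
have me1 j : measurable_fun setT (e1 ^~ j).
  apply: measurable_upd => //.
  by move=> i; apply: (measurableT_comp (me i)).
have mF (F : (nat -> R) -> \bar R) x : borel_coord F ->
    measurable_fun setT (fun z : T * measurableTypeR R => F (merge k.+1 (e1 z) x)).
  by move=> bF; apply: (bF _ _ (fun z => merge k.+1 (e1 z) x)) => j; apply: measurable_merge.
apply: (@LebModel k.+1 _ _ (sprod mu leb) e1) => //.
- move=> j; rewrite ltnS leq_eqVlt => /orP[/eqP ->|jk].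
    rewrite (_ : [set _ | _] = setT `*` [set 0%R]); last first.
      by apply/seteqP; split=> -[t r] /=; rewrite /e1 /upd eqxx// => -[].
    by rewrite [LHS](product_measure1E mu leb)//= lebesgue_measure_set1 mule0.
  rewrite (_ : [set _ | _] = [set t | e t j = 0%R] `*` setT); last first.
    by apply/seteqP; split=> -[t r] /=; rewrite /e1 /upd (ltn_eqF jk)// => -[].
  rewrite [LHS](product_measure1E mu leb)//= ?null_e ?mul0e//.
  have := me j measurableT _ (measurable_set1 0%R).
  by rewrite setTI.
- move=> F bF F0 x /=.
  rewrite [RHS](fubini_tonelli2 (fun z : T * measurableTypeR R => F (merge k.+1 (e1 z) x)))//; last exact: mF.
  apply: eq_integral => r _; rewrite (ge0_e F bF F0).
  by apply: eq_integral => t _; rewrite /= merge_upd.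
- move=> F bF x /= iF'.
  have iF : (mu \x leb).-integrable setT (fun z : T * measurableTypeR R => F (merge k.+1 (e1 z) x)) by [].
  rewrite -[RHS](integral21_prod_meas1 iF).
  (* Only almost every slice is integrable, so [int_e] identifies the inner integrals up to a null
     set of [r]. *)
  apply: ae_eq_integral => //.
  + exact: (borel_upd k x (borel_iint k bF)).
  + apply: (measurable_fubini_G iF).
  have := ae_integrable2 iF; apply: filterS => r ir _.
  rewrite (int_e F bF).
    by apply: eq_integral => t _; rewrite /= merge_upd.
  by under eq_fun do rewrite -merge_upd.
- move=> phi mphi phi0.
  rewrite [LHS](fubini_tonelli2 (fun z : T * measurableTypeR R => (\prod_(j < k.+1) phi (e1 z j))%:E))//; last 2 first.
  + apply/measurable_EFinP; apply: measurable_prod => j _.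
    by apply: (measurableT_comp mphi).
  + by move=> z; rewrite lee_fin; apply: prodr_ge0.
  rewrite expeS -ge0_integralZr//; last 3 first.
  + by apply/measurable_EFinP.
  + by move=> t _; rewrite lee_fin.
  + by apply: expe_ge0; apply: integral_ge0 => t _; rewrite lee_fin.
  apply: eq_integral => r _.
  rewrite -prod_e// -ge0_integralZl//; last 3 first.
  + apply/measurable_EFinP; apply: measurable_prod => j _.
    by apply: (measurableT_comp mphi).
  + by move=> z _; rewrite lee_fin; apply: prodr_ge0.
  + by rewrite lee_fin.
  apply: eq_integral => t _; rewrite -EFinM big_ord_recr/= mulrC /e1/= {1}/upd eqxx.
  congr (_ * _)%:E; apply: eq_bigr => j _.
  by rewrite /upd ltn_eqF.
Qed.

Definition lebesgue_model (k : nat) : leb_model k :=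
  nat_rect leb_model leb_model0 leb_modelS k.

End IteratedIntegral.

(** * Borel functions of a vector and their integrals *)

Section EuclideanModel.
Context {R : realType}.
Local Notation leb := (@lebesgue_measure R).

Definition borel_fun n (g : 'rV[R]_n -> R) :=
  forall d (S : measurableType d) (c : S -> 'rV[R]_n),
    (forall i, measurable_fun setT (fun s => c s ord0 i)) -> measurable_fun setT (g \o c).

Definition row_coord n (x : nat -> R) : 'rV[R]_n := \row_(i < n) x i.

Lemma borel_row_coord n (g : 'rV[R]_n -> R) : borel_fun g ->
  borel_coord (fun x => (g (row_coord n x))%:E).
Proof.
move=> bg d S c mc; apply/measurable_EFinP.
apply: (bg _ _ (fun s => row_coord n (c s))) => i.
by under eq_fun do rewrite mxE; exact: mc.
Qed.

Variable n : nat.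
Let M := @lebesgue_model R n.
Local Notation T := (lm_T M).
Local Notation mu := (lm_mu M).

Definition pt (t : T) : 'rV[R]_n := row_coord n (lm_e t).

Lemma measurable_pt i : measurable_fun setT (fun t => pt t ord0 i).
Proof. by under eq_fun do rewrite mxE; exact: lm_meas. Qed.

Lemma pt_null i : mu [set t | pt t ord0 i = 0] = 0%E.
Proof.
rewrite (_ : [set _ | _] = [set t | lm_e t i = 0]); first exact: lm_null.
by apply/seteqP; split=> t /=; rewrite mxE.
Qed.

Lemma row_merge t x : row_coord n (merge n (lm_e t) x) = pt t.
Proof. by apply/rowP => i; rewrite !mxE /merge ltn_ord. Qed.

Lemma intRn_ge0 (g : 'rV[R]_n -> R) : borel_fun g -> (forall x, 0 <= g x) ->
  intRn (fun y => (g y)%:E) = (\int[mu]_t (g (pt t))%:E)%E.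
Proof.
move=> bg g0; rewrite /intRn -/(row_coord n).
rewrite (lm_ge0 M (borel_row_coord bg)); last by move=> x; rewrite lee_fin.
by apply: eq_integral => t _; rewrite row_merge.
Qed.

Lemma intRn_integrable (g : 'rV[R]_n -> R) : borel_fun g ->
  mu.-integrable setT (fun t => (g (pt t))%:E) ->
  intRn (fun y => (g y)%:E) = (\int[mu]_t (g (pt t))%:E)%E.
Proof.
move=> bg ig; rewrite /intRn -/(row_coord n).
rewrite (@lm_int _ _ M _ (borel_row_coord bg)).
  by apply: eq_integral => t _; rewrite row_merge.
by under eq_fun do rewrite row_merge.
Qed.

Lemma ge0_integral_pt_affine (g : 'rV[R]_n -> R) (c : R) (b : 'rV[R]_n) : c != 0 ->
  borel_fun g -> (forall x, 0 <= g x) ->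
  ((`|c| ^+ n)%:E * \int[mu]_t (g (c *: pt t + b))%:E = \int[mu]_t (g (pt t))%:E)%E.
Proof.
move=> c0 bg g0.
(* The shift is extended by 0 to indices at least [n], which [row_coord] never reads. *)
pose b' j := if insub j is Some i then b ord0 i else 0.
have E x : row_coord n (affine_coord c b' x) = c *: row_coord n x + b.
  by apply/rowP => i; rewrite !mxE /affine_coord /b' valK.
have F0 x : (0%E <= (g (row_coord n x))%:E)%E by rewrite lee_fin.
have := iint_affine n b' (fun=> 0) c0 (borel_row_coord bg) F0.
rewrite (lm_ge0 M (borel_affine c b' (borel_row_coord bg))) => [|x]; last exact: F0.
rewrite (lm_ge0 M (borel_row_coord bg))// => H.
have -> : (\int[mu]_t (g (pt t))%:E = \int[mu]_t (g (row_coord n (merge n (lm_e t) (affine_coord c b' (fun=> 0)))))%:E)%E.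
  by apply: eq_integral => t _; rewrite row_merge.
rewrite -H; congr (_ * _)%E; apply: eq_integral => t _ /=.
by rewrite E row_merge.
Qed.

Lemma integral_pt_prod (phi : R -> R) : measurable_fun setT phi -> (forall t, 0 <= phi t) ->
  (\int[mu]_t (\prod_(j < n) phi (pt t ord0 j))%:E = (\int[leb]_t (phi t)%:E) ^+ n)%E.
Proof.
move=> mphi phi0; rewrite -(lm_prod M)//.
by apply: eq_integral => t _; congr (_ %:E); apply: eq_bigr => j _; rewrite mxE.
Qed.

Lemma borel_affine_fun (g : 'rV[R]_n -> R) (c : R) (b : 'rV[R]_n) :
  borel_fun g -> borel_fun (fun x => g (c *: x + b)).
Proof.
move=> bg d S e me; apply: (bg _ _ (fun s => c *: e s + b)) => i.
under eq_fun do rewrite !mxE.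
by apply: measurable_funD => //; apply: measurable_funM.
Qed.

Lemma measurable_borel (g : 'rV[R]_n -> R) : borel_fun g ->
  measurable_fun setT (fun t => g (pt t)).
Proof. by move=> bg; apply: (bg _ _ pt) => i; exact: measurable_pt. Qed.

Lemma borel_comp (g : 'rV[R]_n -> R) (h : R -> R) :
  borel_fun g -> measurable_fun setT h -> borel_fun (fun x => h (g x)).
Proof. by move=> bg mh d S c mc; apply: (measurableT_comp mh); apply: bg. Qed.

(** Used for translations and for the reflection [z -> - z]. With Jacobian 1, positive and negative
    parts keep their integrals separately, so the identity holds for every Borel [g]. *)
Lemma integral_pt_affine1 (g : 'rV[R]_n -> R) (c : R) (b : 'rV[R]_n) : `|c| = 1 ->
  borel_fun g ->
  (\int[mu]_t (g (c *: pt t + b))%:E = \int[mu]_t (g (pt t))%:E)%E.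
Proof.
move=> c1 bg; have c0 : c != 0 by rewrite -normr_gt0 c1.
have H (h : R -> R) : measurable_fun setT h -> (forall x, 0 <= h x) ->
    (\int[mu]_t (h (g (c *: pt t + b)))%:E = \int[mu]_t (h (g (pt t)))%:E)%E.
  move=> mh h0; rewrite -(@ge0_integral_pt_affine _ c b c0 (borel_comp bg mh))//.
  by rewrite c1 expr1n mul1e.
rewrite integralE [RHS]integralE.
congr (_ - _)%E.
  have := H (fun x => Num.max x 0); rewrite /= => H1.
  transitivity (\int[mu]_t (Num.max (g (c *: pt t + b)) 0)%:E)%E.
    by apply: eq_integral => t _; rewrite funeposE EFin_max.
  rewrite H1.
  - by apply: eq_integral => t _; rewrite funeposE EFin_max.
  - exact: measurable_maxr.
  - by move=> x; rewrite le_max lexx orbT.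
have := H (fun x => Num.max (- x) 0); rewrite /= => H1.
transitivity (\int[mu]_t (Num.max (- g (c *: pt t + b)) 0)%:E)%E.
  by apply: eq_integral => t _; rewrite funenegE EFin_max.
rewrite H1.
- by apply: eq_integral => t _; rewrite funenegE EFin_max.
- by apply: measurable_maxr.
- by move=> x; rewrite le_max lexx orbT.
Qed.

Lemma integrable_pt_affine1 (g : 'rV[R]_n -> R) (c : R) (b : 'rV[R]_n) : `|c| = 1 ->
  borel_fun g -> mu.-integrable setT (fun t => (g (pt t))%:E) ->
  mu.-integrable setT (fun t => (g (c *: pt t + b))%:E).
Proof.
move=> c1 bg /integrableP[_ ig]; apply/integrableP; split.
  by apply/measurable_EFinP; exact: (measurable_borel (borel_affine_fun c b bg)).
have := integral_pt_affine1 b c1 (borel_comp bg (@normr_measurable R setT)).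
by rewrite /= => ->.
Qed.

(** The point [c s] is rounded down to the grid of mesh 1 / (k + 1). The rounded point takes
    countably many values, so [g] of it is measurable, and by continuity it converges to
    [g (c s)]. *)
Lemma borel_continuous (g : 'rV[R]_n -> R) : continuous g -> borel_fun g.
Proof.
move=> cg d S c mc.
pose z (k : nat) (s : S) : 'rV[int]_n := \row_i Num.floor (k.+1%:R * c s ord0 i).
pose h (k : nat) (v : 'rV[int]_n) : 'rV[R]_n := \row_i (k.+1%:R^-1 * (v ord0 i)%:~R).
apply: (@measurable_fun_cvg _ _ _ _ (fun k s => g (h k (z k s)))) => [k|s _].
  move=> _ Y mY; rewrite setTI.
  rewrite (_ : _ @^-1` _ = \bigcup_v (if `[< Y (g (h k v)) >] then z k @^-1` [set v] else set0)); last first.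
    apply/seteqP; split=> s /=.
      by move=> Ys; exists (z k s) => //; rewrite asboolT.
    by move=> [v _]; case: asboolP => // Yv /= ->.
  apply: countable_bigcupT_measurable; first exact: countableP.
  move=> v; case: ifP => // _.
  rewrite (_ : _ @^-1` _ = \bigcap_(i in [set: 'I_n]) ((fun s => k.+1%:R * c s ord0 i) @^-1` `[(v ord0 i)%:~R, (v ord0 i + 1)%:~R[)); last first.
    apply/seteqP; split=> s /=.
      by move=> <- i _ /=; rewrite in_itv/= mxE floor_le// floorD1_gt.
    move=> H; apply/rowP => i; rewrite mxE; apply: floor_def.
    by have := H i I; rewrite /= in_itv.
  apply: fin_bigcap_measurable => // i _.
  rewrite -[X in measurable X]setTI.
  apply: (measurable_funM (measurable_cst _) (mc i)) => //.
suff hz : h k (z k s) @[k --> \oo] --> c s by exact: (cvg_comp _ _ hz (cg (c s))).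
apply/cvg_ballP => e e0; near=> k; split=> // i j.
rewrite ord1 /h /z !mxE /ball/=.
have k0 : 0 < k.+1%:R :> R by rewrite ltr0n.
have -> : c s ord0 j - k.+1%:R^-1 * (Num.floor (k.+1%:R * c s ord0 j))%:~R =
  k.+1%:R^-1 * (k.+1%:R * c s ord0 j - (Num.floor (k.+1%:R * c s ord0 j))%:~R).
  by rewrite mulrBr mulKf// gt_eqF.
rewrite ger0_norm; last by apply: mulr_ge0; rewrite ?subr_ge0 ?floor_le// invr_ge0 ltW.
apply: (@lt_trans _ _ (k.+1%:R^-1 * 1)).
  rewrite ltr_pM2l ?invr_gt0// ltrBlDl -[X in _ < _ + X]/(1%:~R) -intrD.
  exact: floorD1_gt.
rewrite mulr1; near: k.
exact: near_infty_natSinv_lt (PosNum e0).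
Unshelve. all: by end_near.
Qed.

End EuclideanModel.

(** * Power functions on the line *)

Section PowerIntegrals.
Context {R : realType}.
Local Notation leb := (@lebesgue_measure R).

Lemma powR_le_neg (x y p : R) : 0 < x -> x <= y -> p <= 0 -> y `^ p <= x `^ p.
Proof.
move=> x0 xy p0; have y0 := lt_le_trans x0 xy.
have : - p >= 0 by rewrite oppr_ge0.
rewrite -[p in _ -> y `^ p <= _ `^ p]opprK; move: (- p) => q q0.
rewrite !powRN lef_pV2 ?posrE ?powR_gt0//.
by apply: ge0_ler_powR; rewrite ?nnegrE// ltW.
Qed.

Lemma powR_le1 (x p : R) : 1 <= x -> p <= 0 -> x `^ p <= 1.
Proof. by move=> x1 p0; have := powR_le_neg ltr01 x1 p0; rewrite powR1. Qed.

Lemma powR_ge1 (x p : R) : 0 < x -> x <= 1 -> p <= 0 -> 1 <= x `^ p.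
Proof. by move=> x0 x1 p0; have := powR_le_neg x0 x1 p0; rewrite powR1. Qed.

Lemma measurable_powR_EFin (D : set R) (p : R) : measurable_fun D (fun x : R => (x `^ p)%:E).
Proof.
by apply/measurable_EFinP; apply: (measurable_funS measurableT) => //; exact: measurable_powR.
Qed.

Lemma integral_powR (x y p : R) : 0 < x -> x <= y -> p != 0 ->
  (\int[leb]_(t in `[x, y]) (t `^ (p - 1))%:E = ((y `^ p - x `^ p) / p)%:E)%E.
Proof.
move=> x0; rewrite le_eqVlt => /orP[/eqP <-|xy] p0.
  by rewrite set_itv1 integral_set1 subrr mul0r.
have D (q : R) t : 0 < t -> derivable (fun z : R => z `^ q) t 1.
  by move=> t0; apply: ex_derive; exact: is_derive1_powR.
have C (q t : R) : 0 < t -> {for t, continuous (fun z : R => z `^ q)}.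
  by move=> t0; apply: differentiable_continuous; apply/derivable1_diffP; exact: D.
have y0 := lt_trans x0 xy.
rewrite (@continuous_FTC2 _ _ (fun z => p^-1 * z `^ p) _ _ xy).
- by rewrite -EFinB -mulrBr mulrC.
- apply: derivable_within_continuous => t; rewrite in_itv/= => /andP[xt _].
  by apply: D; exact: lt_le_trans xt.
- split.
  + move=> t; rewrite in_itv/= => /andP[xt _].
    by apply: derivableM => //; apply: D; exact: lt_trans xt.
  + apply: cvg_at_right_filter; apply: cvgM; first exact: cvg_cst.
    exact: C.
  + apply: cvg_at_left_filter; apply: cvgM; first exact: cvg_cst.
    exact: C.
- move=> t; rewrite in_itv/= => /andP[xt _].
  have t0 := lt_trans x0 xt.
  rewrite derive1E deriveM//; last exact: D.
  rewrite derive_cst scaler0 addr0.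
  have := is_derive1_powR p t0 => H; rewrite derive_val.
  by rewrite /GRing.scale/= mulKf.
Qed.

Lemma ge0_integral_le_bigcup d (T : measurableType d) (m : {measure set T -> \bar R})
    (F : nat -> set T) (f : T -> \bar R) (B : \bar R) :
  {homo F : i j / (i <= j)%N >-> (i <= j)%O} -> (forall i, measurable (F i)) ->
  measurable_fun setT f -> (forall x, 0 <= f x)%E ->
  (forall i, (\int[m]_(x in F i) f x <= B)%E) ->
  (\int[m]_(x in \bigcup_i F i) f x <= B)%E.
Proof.
move=> ndF mF mf f0 fB.
have := @ge0_nondecreasing_set_cvg_integral _ _ _ F f m ndF mF
  (fun i => measurable_funS measurableT (@subsetT _ _) mf) (fun _ x _ => f0 x).
by apply: cvge_le; apply: nearW.
Qed.

(** The integrand may blow up at 0, so the fundamental theorem is applied on [[y / (i + 1), y]] and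
    monotone convergence does the rest. *)
Lemma integral_powR_le (y p : R) : 0 < y -> 0 < p ->
  (\int[leb]_(t in `]0%R, y]) (t `^ (p - 1))%:E <= (y `^ p / p)%:E)%E.
Proof.
move=> y0 p0.
pose F (i : nat) : set R := `[y / i.+1%:R, y]%classic.
have -> : `]0, y]%classic = \bigcup_i F i.
  apply/seteqP; split=> t /=; rewrite in_itv/=.
    move=> /andP[t0 ty].
    have H0 : 0 < t / y by exact: divr_gt0.
    have [k] := ltr_add_invr H0.
    rewrite add0r => H; exists k => //=; rewrite /F/= in_itv/= ty andbT.
    by rewrite mulrC -ler_pdivlMr// ltW.
  move=> [k _]; rewrite /F/= in_itv/= => /andP[yt ->]; rewrite andbT.
  by apply: lt_le_trans yt; apply: divr_gt0.
apply: ge0_integral_le_bigcup.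
- move=> i j ij; apply/subsetPset => t; rewrite /F/= !in_itv/= => /andP[H ->]; rewrite andbT.
  by apply: le_trans H; rewrite ler_pM2l// lef_pV2 ?posrE// ler_nat.
- by move=> i; exact: measurable_itv.
- exact: measurable_powR_EFin.
- by move=> x; rewrite lee_fin powR_ge0.
- move=> i; rewrite integral_powR ?gt_eqF//.
  + rewrite lee_fin ler_pM2r ?invr_gt0// lerBlDr lerDl powR_ge0//.
  + by apply: divr_gt0.
  + by rewrite ler_pdivrMr// ler_peMr ?ler1n// ltW.
Qed.

Lemma integral_powR_tail (p : R) : 0 < p ->
  (\int[leb]_(t in `[1%R, +oo[) (t `^ (- p - 1))%:E <= (p^-1)%:E)%E.
Proof.
move=> p0.
pose F (i : nat) : set R := `[1, i.+1%:R]%classic.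
have -> : `[1, +oo[%classic = \bigcup_i F i.
  apply/seteqP; split=> t /=; rewrite in_itv/= ?andbT.
    move=> t1; exists (Num.truncn t) => //=; rewrite /F/= in_itv/= t1/=.
    by rewrite ltW// truncnS_gt.
  by move=> [k _]; rewrite /F/= in_itv/= => /andP[].
apply: ge0_integral_le_bigcup.
- move=> i j ij; apply/subsetPset => t; rewrite /F/= !in_itv/= => /andP[-> H]/=.
  by apply: le_trans H _; rewrite ler_nat.
- by move=> i; exact: measurable_itv.
- exact: measurable_powR_EFin.
- by move=> x; rewrite lee_fin powR_ge0.
- move=> i; rewrite integral_powR ?oppr_eq0 ?gt_eqF// ?ler1n//.
  rewrite lee_fin powR1 invrN mulrN -mulNr opprB -[leRHS]mul1r ler_pM2r ?invr_gt0// lerBlDr lerDl powR_ge0.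
Qed.

(** One-dimensional profile with integrable behaviour at 0 (for [a > 0]) and at infinity (for
    [b > 0]); products of it over the coordinates will majorize [domin]. *)
Definition two_power (a b : R) (t : R) : R :=
  if `|t| <= 1 then `|t| `^ (a - 1) else `|t| `^ (- b - 1).

Lemma two_power_ge0 a b t : 0 <= two_power a b t.
Proof. by rewrite /two_power; case: ifP => _; exact: powR_ge0. Qed.

Lemma measurable_two_power a b : measurable_fun setT (two_power a b).
Proof.
apply: measurable_fun_ifT.
- by apply: measurable_fun_ler => //; exact: normr_measurable.
- by apply: (measurableT_comp (measurable_powR _)); exact: normr_measurable.
- by apply: (measurableT_comp (measurable_powR _)); exact: normr_measurable.
Qed.

Lemma integral_two_power (a b : R) : 0 < a -> a < 1 -> 0 < b ->
  (\int[leb]_t (two_power a b t)%:E < +oo)%E.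
Proof.
move=> a0 a1 b0.
pose f t : \bar R := ((two_power a b t) * (if 0 < t then 1 else 0))%:E.
have mf : measurable_fun setT f.
  apply/measurable_EFinP; apply: measurable_funM; first exact: measurable_two_power.
  by apply: measurable_fun_ifT => //; apply: measurable_fun_ltr.
have f0 t : (0 <= f t)%E.
  by rewrite lee_fin mulr_ge0 ?two_power_ge0//; case: ifP.
have E t : (two_power a b t)%:E = (f t + f (- 1 * t + 0)%R)%E.
  rewrite /f addr0 mulN1r oppr_gt0 -EFinD /two_power normrN; congr EFin.
  have [t0|t0|<-] := ltrgtP 0 t; rewrite ?mulr0 ?mulr1 ?addr0 ?add0r//.
  (* At [t = 0] both sides vanish, because [powR 0 (a - 1)] is 0 when [a] differs from 1. *)
  by rewrite normr0 ler01 powR0// subr_eq0 lt_eqF.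
under eq_integral do rewrite E.
rewrite ge0_integralD//; last by apply: (measurableT_comp mf); apply: measurable_funD => //; apply: measurable_funM.
have := @ge0_integral_affine R (-1) 0 f; rewrite oppr_eq0 oner_eq0 => /(_ isT mf f0).
rewrite normrN1 mul1e => ->.
suff: (\int[leb]_t f t < +oo)%E by move=> H; apply: lte_add_pinfty.
pose f1 : R -> \bar R := (fun t => (t `^ (a - 1))%:E) \_ `]0, 1].
pose f2 : R -> \bar R := (fun t => (t `^ (- b - 1))%:E) \_ `[1, +oo[.
have mf1 : measurable_fun setT f1.
  by apply/(measurable_restrictT _ _).1 => //; exact: measurable_powR_EFin.
have mf2 : measurable_fun setT f2.
  by apply/(measurable_restrictT _ _).1 => //; exact: measurable_powR_EFin.
have f10 t : (0 <= f1 t)%E by apply: erestrict_ge0 => x _; rewrite lee_fin powR_ge0.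
have f20 t : (0 <= f2 t)%E by apply: erestrict_ge0 => x _; rewrite lee_fin powR_ge0.
have le_f t : (f t <= f1 t + f2 t)%E.
  rewrite /f; have [t0|_] := boolP (0 < t); last by rewrite mulr0 adde_ge0.
  rewrite mulr1 /two_power gtr0_norm//; case: ifPn => [t1|].
    rewrite (_ : f1 t = (t `^ (a - 1))%:E) ?leeDl//.
    by rewrite /f1 patchT// inE/= in_itv/= t0.
  rewrite -ltNge => t1.
  rewrite (_ : f2 t = (t `^ (- b - 1))%:E) ?leeDr//.
  by rewrite /f2 patchT// inE/= in_itv/= ltW.
apply: (@le_lt_trans _ _ (\int[leb]_t (f1 t + f2 t))%E).
  by apply: ge0_le_integral => //; apply: emeasurable_funD.
rewrite ge0_integralD//; apply: lte_add_pinfty.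
  rewrite /f1 -integral_mkcond; apply: le_lt_trans (integral_powR_le ltr01 a0) _.
  by rewrite ltry.
rewrite /f2 -integral_mkcond; apply: le_lt_trans (integral_powR_tail b0) _.
by rewrite ltry.
Qed.

End PowerIntegrals.

(** * Integration on R^n *)

Section EuclideanNorm.
Context {R : realType} {n : nat}.
Implicit Types x y : 'rV[R]_n.

Lemma enorm_ge0 x : 0 <= enorm x.
Proof. exact: sqrtr_ge0. Qed.

Lemma sqr_enorm x : enorm x ^+ 2 = \sum_(i < n) x ord0 i ^+ 2.
Proof. by rewrite sqr_sqrtr// sumr_ge0// => i _; rewrite sqr_ge0. Qed.

Lemma enormZ (c : R) x : enorm (c *: x) = `|c| * enorm x.
Proof.
rewrite /enorm -sqrtr_sqr -sqrtrM ?sqr_ge0//; congr Num.sqrt.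
by rewrite mulr_sumr; apply: eq_bigr => i _; rewrite !mxE exprMn.
Qed.

Lemma enormN x : enorm (- x) = enorm x.
Proof. by rewrite -scaleN1r enormZ normrN1 mul1r. Qed.

Lemma enorm0 : enorm (0 : 'rV[R]_n) = 0.
Proof. by rewrite -(scale0r 0) enormZ normr0 mul0r. Qed.

Lemma normr_le_enorm x i : `|x ord0 i| <= enorm x.
Proof.
rewrite -sqrtr_sqr ler_sqrt ?sumr_ge0//; last by move=> j _; rewrite sqr_ge0.
by rewrite (bigD1 i)//= lerDl sumr_ge0// => j _; rewrite sqr_ge0.
Qed.

Lemma borel_enorm : borel_fun (@enorm R n).
Proof.
move=> d S c mc.
have E s : (@enorm R n \o c) s = (\sum_(i < n) c s ord0 i ^+ 2) `^ 2^-1.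
  by rewrite powR12_sqrt// sumr_ge0// => i _; rewrite sqr_ge0.
rewrite (funext E); apply: (measurableT_comp (measurable_powR _)).
by apply: measurable_sum => i; apply: measurable_funX.
Qed.

Lemma borel_enorm_powR (p : R) : borel_fun (fun x => enorm x `^ p).
Proof. exact: (borel_comp borel_enorm (measurable_powR p)). Qed.

Lemma borel_coordinate i : borel_fun (fun x => x ord0 i).
Proof. by move=> d S c mc; exact: mc. Qed.

Lemma borel_cst (a : R) : borel_fun (fun _ : 'rV[R]_n => a).
Proof. by move=> d S c mc; exact: measurable_cst. Qed.

Lemma borelD (g h : 'rV[R]_n -> R) : borel_fun g -> borel_fun h -> borel_fun (fun x => g x + h x).
Proof. by move=> bg bh d S c mc; apply: measurable_funD; [exact: bg|exact: bh]. Qed.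

Lemma borelM (g h : 'rV[R]_n -> R) : borel_fun g -> borel_fun h -> borel_fun (fun x => g x * h x).
Proof. by move=> bg bh d S c mc; apply: measurable_funM; [exact: bg|exact: bh]. Qed.

Lemma borelB (g h : 'rV[R]_n -> R) : borel_fun g -> borel_fun h -> borel_fun (fun x => g x - h x).
Proof. by move=> bg bh d S c mc; apply: measurable_funB; [exact: bg|exact: bh]. Qed.

Lemma borel_sum I (r : seq I) (g : I -> 'rV[R]_n -> R) :
  (forall i, borel_fun (g i)) -> borel_fun (fun x => \sum_(i <- r) g i x).
Proof. by move=> bg d S c mc; apply: measurable_sum => i; apply: (bg i). Qed.

Lemma borel_ifle (f1 f2 g h : 'rV[R]_n -> R) : borel_fun f1 -> borel_fun f2 ->
  borel_fun g -> borel_fun h -> borel_fun (fun x => if f1 x <= f2 x then g x else h x).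
Proof.
move=> b1 b2 bg bh d S c mc; apply: measurable_fun_ifT; [|exact: bg|exact: bh].
by apply: measurable_fun_ler; [exact: b1|exact: b2].
Qed.

Lemma borel_iflt (f1 f2 g h : 'rV[R]_n -> R) : borel_fun f1 -> borel_fun f2 ->
  borel_fun g -> borel_fun h -> borel_fun (fun x => if f1 x < f2 x then g x else h x).
Proof.
move=> b1 b2 bg bh d S c mc; apply: measurable_fun_ifT; [|exact: bg|exact: bh].
by apply: measurable_fun_ltr; [exact: b1|exact: b2].
Qed.

Lemma borelN (h : 'rV[R]_n -> R) : borel_fun h -> borel_fun (fun z => h (- z)).
Proof.
move=> bh d S c mc; apply: (bh _ _ (fun t => - c t)) => i.
by under eq_fun do rewrite mxE; exact: measurable_funN.
Qed.

Lemma borelZ (a : R) (h : 'rV[R]_n -> R) : borel_fun h -> borel_fun (fun z => a * h z).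
Proof. by move=> bh; apply: (borelM (borel_cst a) bh). Qed.

End EuclideanNorm.

Section RealIntegral.
Context {R : realType} {n : nat}.
Local Notation T := (lm_T (@lebesgue_model R n)).
Local Notation mu := (lm_mu (@lebesgue_model R n)).
Local Notation pt := (@pt R n).
Implicit Types g h : 'rV[R]_n -> R.

Definition rv_integrable g := mu.-integrable setT (fun t => (g (pt t))%:E).
Definition rint g : R := \int[mu]_t g (pt t).

Lemma rintE g : rv_integrable g -> (\int[mu]_t (g (pt t))%:E)%E = (rint g)%:E.
Proof. by move=> ig; rewrite /rint /Rintegral fineK//; exact: integrable_fin_num. Qed.

Lemma rv_integrableD g h : rv_integrable g -> rv_integrable h ->
  rv_integrable (fun x => g x + h x).
Proof. by move=> ig ih; rewrite /rv_integrable; under eq_fun do rewrite EFinD; exact: integrableD. Qed.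

Lemma rv_integrableB g h : rv_integrable g -> rv_integrable h ->
  rv_integrable (fun x => g x - h x).
Proof. by move=> ig ih; rewrite /rv_integrable; under eq_fun do rewrite EFinB; exact: integrableB. Qed.

Lemma rv_integrableZ (a : R) g : rv_integrable g -> rv_integrable (fun x => a * g x).
Proof. by move=> ig; rewrite /rv_integrable; under eq_fun do rewrite EFinM; exact: integrableZl. Qed.

Lemma rv_integrable_sum I (r : seq I) (g : I -> 'rV[R]_n -> R) :
  (forall i, rv_integrable (g i)) -> rv_integrable (fun x => \sum_(i <- r) g i x).
Proof.
move=> ig; elim: r => [|i r IH].
  by rewrite /rv_integrable; under eq_fun do rewrite big_nil; exact: integrable0.
rewrite (_ : (fun x => _) = fun x => g i x + \sum_(i0 <- r) g i0 x); first exact: rv_integrableD.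
by apply/funext => x; rewrite big_cons.
Qed.

Lemma rintD g h : rv_integrable g -> rv_integrable h ->
  rint (fun x => g x + h x) = rint g + rint h.
Proof. by move=> ig ih; rewrite /rint RintegralD. Qed.

Lemma rintB g h : rv_integrable g -> rv_integrable h ->
  rint (fun x => g x - h x) = rint g - rint h.
Proof. by move=> ig ih; rewrite /rint RintegralB. Qed.

Lemma rintZ (a : R) g : rv_integrable g -> rint (fun x => a * g x) = a * rint g.
Proof. by move=> ig; rewrite /rint RintegralZl. Qed.

Lemma rint_sum I (r : seq I) (g : I -> 'rV[R]_n -> R) :
  (forall i, rv_integrable (g i)) ->
  rint (fun x => \sum_(i <- r) g i x) = \sum_(i <- r) rint (g i).
Proof.
move=> ig; elim: r => [|i r IH].
  rewrite big_nil; under [LHS]eq_Rintegral do rewrite big_nil.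
  by rewrite /Rintegral integral0.
rewrite big_cons -IH -rintD//; last exact: rv_integrable_sum.
by apply: eq_Rintegral => t _; rewrite big_cons.
Qed.

Lemma rint_ge0 g : (forall x, 0 <= g x) -> 0 <= rint g.
Proof. by move=> g0; apply: Rintegral_ge0. Qed.

Lemma eq_rint g h : (forall x, g x = h x) -> rint g = rint h.
Proof. by move=> /funext ->. Qed.

Lemma rint_affine1 (c : R) (b : 'rV[R]_n) g : `|c| = 1 -> borel_fun g ->
  rint (fun x => g (c *: x + b)) = rint g.
Proof. by move=> c1 bg; rewrite /rint /Rintegral integral_pt_affine1. Qed.

Lemma rint_norm_le g h : rv_integrable g -> rv_integrable h ->
  (forall x, `|g x| <= h x) -> `|rint g| <= rint h.
Proof.
move=> ig ih gh; apply: le_trans (le_normr_Rintegral measurableT ig) _.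
apply: le_Rintegral => //.
by have := integrable_norm ig; under eq_fun do rewrite /=.
Qed.

Lemma rv_integrable_le g h : borel_fun g -> rv_integrable h ->
  (forall x, `|g x| <= h x) -> rv_integrable g.
Proof.
move=> bg ih gh; apply: (le_integrable measurableT _ _ ih).
  by apply/measurable_EFinP; exact: (measurable_borel bg).
move=> t _; rewrite /= lee_fin; apply: le_trans (gh _) _; exact: ler_norm.
Qed.

End RealIntegral.

(** * An integrable majorant *)

Section Dominator.
Context {R : realType} {n : nat}.
Variable s : R.
Hypotheses (n_gt0 : (0 < n)%N) (s01 : 0 < s < 1).

(* Integrable, and dominates all kernels below after their cancellation at the
   origin has been taken into account. *)
Definition domin (h : 'rV[R]_n) : R :=
  if enorm h <= 1 then enorm h `^ (1 - s - n%:R) else enorm h `^ (- s - n%:R).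

Lemma domin_ge0 h : 0 <= domin h.
Proof. by rewrite /domin; case: ifP => _; exact: powR_ge0. Qed.

Lemma borel_domin : borel_fun domin.
Proof.
by apply: borel_ifle; [exact: borel_enorm|exact: borel_cst|exact: borel_enorm_powR|exact: borel_enorm_powR].
Qed.

(** The exponent of [enorm h] is split evenly among the coordinates. Each share is negative and
    [|h_i| <= enorm h], so passing to [|h_i|] increases every factor; when [enorm h > 1] but
    [|h_i| <= 1], the number 1 lies between the two. Coordinates equal to 0 are excluded since
    [powR] vanishes there. Integrability thereby reduces to dimension one. *)
Lemma domin_le_prod (h : 'rV[R]_n) : (forall i, h ord0 i != 0) ->
  domin h <= \prod_(i < n) two_power ((1 - s) / n%:R) (s / n%:R) (h ord0 i).
Proof.
move=> hn0; have /andP[s0 s1] := s01.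
have n0 : 0 < n%:R :> R by rewrite ltr0n.
have n1 : 1 <= n%:R :> R by rewrite ler1n.
have h0 i : 0 < `|h ord0 i| by rewrite normr_gt0.
have a1 : (1 - s) / n%:R - 1 <= 0 by rewrite subr_le0 ler_pdivrMr//; lra.
have b1 : - (s / n%:R) - 1 <= 0.
  have : 0 < s / n%:R by exact: divr_gt0.
  by lra.
have E (y p : R) : y `^ (p * n%:R) = \prod_(i < n) y `^ p.
  by rewrite prodr_const card_ord powRrM powR_mulrn ?powR_ge0.
rewrite /domin; case: ifPn => [h1|].
  rewrite (_ : 1 - s - n%:R = ((1 - s) / n%:R - 1) * n%:R); last by rewrite mulrBl mul1r ?mulNr divfK ?gt_eqF.
  rewrite E; apply: ler_prod => i _; rewrite powR_ge0/= /two_power.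
  have hi := normr_le_enorm h i.
  by rewrite (le_trans hi h1); apply: powR_le_neg.
rewrite -ltNge => h1.
rewrite (_ : - s - n%:R = (- (s / n%:R) - 1) * n%:R); last by rewrite mulrBl mul1r ?mulNr divfK ?gt_eqF.
rewrite E; apply: ler_prod => i _; rewrite powR_ge0/= /two_power.
have hi := normr_le_enorm h i.
case: ifPn => [hi1|_]; last exact: powR_le_neg.
by apply: (@le_trans _ _ 1); [apply: powR_le1 => //; exact: ltW|exact: powR_ge1].
Qed.

Lemma integrable_domin : rv_integrable domin.
Proof.
have /andP[s0 s1] := s01.
have n0 : 0 < n%:R :> R by rewrite ltr0n.
have n1 : 1 <= n%:R :> R by rewrite ler1n.
apply/integrableP; split; first by apply/measurable_EFinP; exact: (measurable_borel borel_domin).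
set a := (1 - s) / n%:R; set b := s / n%:R.
apply: (@le_lt_trans _ _ (\int[lm_mu (@lebesgue_model R n)]_t (\prod_(i < n) two_power a b (pt t ord0 i))%:E)%E); last first.
  rewrite integral_pt_prod.
  - have fin : (\int[lebesgue_measure]_t (two_power a b t)%:E)%E \is a fin_num.
      rewrite ge0_fin_numE; last by apply: integral_ge0 => t _; rewrite lee_fin two_power_ge0.
      apply: integral_two_power; rewrite /a /b ?divr_gt0 ?subr_gt0//.
      by rewrite ltr_pdivrMr//; lra.
    by rewrite -(fineK fin) -EFin_expe ltry.
  - exact: measurable_two_power.
  - exact: two_power_ge0.
apply: ae_ge0_le_integral => //.
- by apply/measurable_EFinP; apply: measurableT_comp => //; exact: (measurable_borel borel_domin).
- by move=> t _; rewrite lee_fin prodr_ge0// => i _; exact: two_power_ge0.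
- apply/measurable_EFinP; apply: measurable_prod => i _.
  apply: (measurableT_comp (measurable_two_power _ _)); exact: measurable_pt.
(* The coordinate hyperplanes, not covered by [domin_le_prod], are null. *)
have : \forall t \ae lm_mu (@lebesgue_model R n), forall i, pt t ord0 i != 0.
  apply: filter_forall => i; exists [set t | pt t ord0 i = 0]; split.
  - have := @measurable_pt R n i measurableT _ (measurable_set1 0).
    by rewrite setTI.
  - exact: pt_null.
  - by move=> t /= /negP; rewrite negbK => /eqP.
apply: filterS => t hn0 _; rewrite /= lee_fin ger0_norm ?domin_ge0//.
exact: domin_le_prod.
Qed.

Lemma rv_integrable_dom g (C : R) : borel_fun g -> (forall x, `|g x| <= C * domin x) ->
  rv_integrable g.
Proof.
by move=> bg gC; apply: (rv_integrable_le bg (rv_integrableZ C integrable_domin)).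
Qed.

Lemma rint_dom_le g (C : R) : borel_fun g -> (forall x, `|g x| <= C * domin x) ->
  `|rint g| <= C * rint domin.
Proof.
move=> bg gC; rewrite -rintZ; last exact: integrable_domin.
apply: rint_norm_le => //; last exact: (rv_integrableZ C integrable_domin).
exact: rv_integrable_dom gC.
Qed.

End Dominator.

(** * Finite differences of smooth functions *)

Section Differences.
Context {R : realType} {n : nat}.
Implicit Types (g : 'rV[R]_n -> R) (a b x : 'rV[R]_n).

Definition diff a g : 'rV[R]_n -> R := fun x => g (x + a) - g x.

Definition diffs (l : seq 'rV[R]_n) g : 'rV[R]_n -> R := foldr diff g l.

(** The gain of one finite difference of a bounded function with bounded gradient: linear for small
    increments, constant for large ones. *)
Definition min1 a : R := Num.min 1 (enorm a).

Lemma min1_ge0 a : 0 <= min1 a.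
Proof. by rewrite /min1 le_min ler01 enorm_ge0. Qed.

Lemma diffsS a l g x : diffs (a :: l) g x = diffs l g (x + a) - diffs l g x.
Proof. by []. Qed.

Lemma diff_quotient_shift g a x v :
  (fun h : R => h^-1 *: (g (h *: v + x + a) - g (x + a))) =
  (fun h : R => h^-1 *: (g (h *: v + (x + a)) - g (x + a))).
Proof. by apply/funext => h; rewrite addrA. Qed.

Lemma derivable_shift g a x v : derivable g (x + a) v -> derivable (fun z => g (z + a)) x v.
Proof. by move=> dg; rewrite /derivable diff_quotient_shift. Qed.

Lemma derive_shift g a x v : 'D_v (fun z => g (z + a)) x = 'D_v g (x + a).
Proof. by rewrite /derive diff_quotient_shift. Qed.

Lemma derivable_diff g a v : (forall x, derivable g x v) -> forall x, derivable (diff a g) x v.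
Proof. by move=> dg x; apply: derivableB => //; exact: derivable_shift. Qed.

Lemma derive_diff g a v : (forall x, derivable g x v) -> forall x,
  'D_v (diff a g) x = diff a (fun z => 'D_v g z) x.
Proof.
move=> dg x; rewrite deriveB//; first by rewrite derive_shift.
exact: derivable_shift.
Qed.

Lemma derivable_diffs g l v : (forall x, derivable g x v) -> forall x, derivable (diffs l g) x v.
Proof. by move=> dg; elim: l => [|a l IH]; [exact: dg|exact: derivable_diff]. Qed.

Lemma derive_diffs g l v : (forall x, derivable g x v) -> forall x,
  'D_v (diffs l g) x = diffs l (fun z => 'D_v g z) x.
Proof.
move=> dg; elim: l => //= a l IH x; rewrite derive_diff; last exact: derivable_diffs.
by rewrite (funext IH).
Qed.

Lemma diff_line g v (B : R) : (forall x, derivable g x v) -> (forall x, `|'D_v g x| <= B) ->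
  forall x (t : R), `|g (x + t *: v) - g x| <= B * `|t|.
Proof.
move=> dg gB.
have H x (t : R) : 0 < t -> `|g (x + t *: v) - g x| <= B * `|t|.
  move=> t0; pose f (r : R) := g (x + r *: v).
  have df (r : R) : is_derive r 1 f ('D_v g (x + r *: v)).
    have E : (fun h : R => h^-1 *: (f (h *: 1 + r) - f r)) =
             (fun h : R => h^-1 *: (g (h *: v + (x + r *: v)) - g (x + r *: v))).
      apply/funext => h; rewrite /f; congr (_ *: (g _ - _)).
      by rewrite [h *: 1]mulr1 scalerDl addrCA.
    apply: DeriveDef; first by rewrite /derivable E; exact: dg.
    by rewrite /derive E.
  have cf : {within `[0, t], continuous f}.
    by apply: derivable_within_continuous => r _; exact: ex_derive.
  have [c _] := MVT t0 (fun r _ => df r) cf.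
  rewrite /f subr0 scale0r addr0 => ->.
  by rewrite normrM ler_wpM2r.
move=> x t; have [t0|t0|->] := ltrgtP t 0; last first.
- by rewrite scale0r addr0 subrr normr0 mulr0.
- exact: H.
have := H (x + t *: v) (- t); rewrite oppr_gt0 => /(_ t0).
by rewrite scaleNr addrK normrN distrC.
Qed.

(** The increment [a] is walked one coordinate at a time, so that only derivatives along basis
    vectors, those provided by [Ck], occur; this costs the factor [n]. *)
Lemma diff_le g (B : R) : (forall i x, derivable g x (ebasis R i)) ->
  (forall i x, `|partial i g x| <= B) -> forall a x, `|diff a g x| <= n%:R * B * enorm a.
Proof.
move=> dg gB a x.
have H r : `|g (x + \sum_(i <- r) a ord0 i *: ebasis R i) - g x| <= \sum_(i <- r) B * enorm a.
  elim: r => [|i r IH].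
    by rewrite !big_nil addr0 subrr normr0.
  rewrite !big_cons [X in x + X]addrC addrA.
  set y := x + _ in IH *.
  rewrite -(subrK (g y) (g (y + _))) -addrA; apply: le_trans (ler_normD _ _) _.
  apply: lerD => //.
  apply: le_trans (diff_line (dg i) (gB i) y (a ord0 i)) _.
  rewrite ler_wpM2l ?normr_le_enorm//.
  by apply: le_trans (gB i x).
have := H (index_enum 'I_n).
by rewrite -row_sum_delta sumr_const card_ord -mulrA mulr_natl.
Qed.

(* Coordinatewise support condition: it is visibly open, so partial derivatives inherit it. *)
Definition cube_support (M : R) g := forall x i, M < `|x ord0 i| -> g x = 0.

Lemma cube_support_partial M g i : cube_support M g -> cube_support M (partial i g).
Proof.
move=> gM x j xj; apply: norm_lim_near_cst.
near=> h; rewrite /= (gM x j xj) (gM (h *: ebasis R i + x) j) ?subrr ?scaler0//.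
rewrite !mxE eqxx/=.
apply: (@lt_le_trans _ _ (`|x ord0 j| - `|h|)).
  rewrite ltrBrDr addrC -ltrBrDr; near: h.
  by apply: dnbhs0_lt; rewrite subr_gt0.
rewrite lerBlDr -{1}(addrK (h * (j == i)%:R) (x ord0 j)) [x ord0 j + _]addrC.
apply: le_trans (ler_normB _ _) _; rewrite lerD2l normrM.
by case: (j == i); rewrite ?normr1 ?mulr1 ?normr0 ?mulr0.
Unshelve. all: by end_near.
Qed.

Lemma cube_support_bounded M g : continuous g -> cube_support M g ->
  exists C, forall x, `|g x| <= C.
Proof.
move=> cg gM.
have cA : compact [set v : 'rV[R]_n | forall i, v ord0 i \in `[- M, M]].
  apply: (@rV_compact _ _ (fun=> `[- M, M]%classic)).
  by move=> _; apply: segment_compact.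
have := continuous_compact (continuous_subspaceT cg) cA.
move=> /compact_bounded [B [_ HB]].
exists (Num.max 0 (B + 1)) => x.
have [H|] := pselect (forall i, `|x ord0 i| <= M).
  rewrite le_max; apply/orP; right; apply: HB; first by rewrite ltrDl.
  by exists x => // i; rewrite /= in_itv/= -ler_norml.
move=> /existsNP[i /negP]; rewrite -ltNge => /gM ->.
by rewrite normr0 le_max lexx.
Qed.

(** What the estimates retain of [smooth_compact]. Unlike a bound on finitely many derivatives, it
    is stable under [partial], as the induction in [diffs_bound] demands. *)
Definition smooth_bounded g :=
  (forall l i x, derivable (Dseq l g) x (ebasis R i)) /\
  (forall l, exists C, forall x, `|Dseq l g x| <= C).

Lemma smooth_compact_bounded g : smooth_compact g -> smooth_bounded g.
Proof.
move=> [sg [M gM]].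
have sup0 : cube_support M g.
  by move=> x i xi; apply: gM; apply: lt_le_trans xi (normr_le_enorm x i).
have supl l : cube_support M (Dseq l g).
  by elim: l => //= i l IH; apply: cube_support_partial.
split=> [l i x|l]; first by have [H _] := sg (size l).+1; exact: H.
by apply: (cube_support_bounded _ (supl l)); have [_ H] := sg (size l); exact: H.
Qed.

Lemma Dseq_partial l i g : Dseq l (partial i g) = Dseq (rcons l i) g.
Proof. by rewrite /Dseq foldr_rcons. Qed.

Lemma smooth_bounded_partial i g : smooth_bounded g -> smooth_bounded (partial i g).
Proof. by move=> [dg bg]; split=> [l j x|l]; rewrite Dseq_partial. Qed.

(** Induction on the order. If [enorm a >= 1], the outer difference is split into two differences of
    order [k], whence [2 * C0]. Otherwise the mean value bound applies, since derivatives commute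
    with differences, and the induction hypothesis for the partial derivatives gives [n * C1]. *)
Lemma diffs_bound g k : smooth_bounded g ->
  exists2 C, 0 <= C & forall l x, size l = k -> `|diffs l g x| <= C * \prod_(a <- l) min1 a.
Proof.
elim: k g => [|k IH] g sg.
  have [_ /(_ [::])[C HC]] := sg.
  exists C; first by apply: le_trans (HC 0).
  by move=> [|a l]// x _; rewrite big_nil mulr1; exact: HC.
have [C0 C0_ge0 HC0] := IH _ sg.
have /choice[Ci HCi] : forall i : 'I_n, exists C, 0 <= C /\ forall l x, size l = k ->
    `|diffs l (partial i g) x| <= C * \prod_(a <- l) min1 a.
  by move=> i; have [C ? ?] := IH _ (smooth_bounded_partial i sg); exists C.
pose C1 := \sum_i Ci i.
have C1_ge0 : 0 <= C1 by apply: sumr_ge0 => i _; case: (HCi i).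
exists (2 * C0 + n%:R * C1); first by rewrite addr_ge0 ?mulr_ge0.
move=> [//|a l] x [lk]; rewrite big_cons mulrCA.
set P := \prod_(b <- l) min1 b.
have P0 : 0 <= P by apply: prodr_ge0 => b _; exact: min1_ge0.
have [a1|a1] := leP 1 (enorm a).
  rewrite /min1 min_l// mul1r mulrDl diffsS; apply: le_trans (ler_normB _ _) _.
  apply: (@le_trans _ _ (2 * C0 * P)); last by rewrite lerDl !mulr_ge0.
  rewrite -mulrA mulr_natl mulr2n; apply: lerD; exact: HC0.
rewrite /min1 min_r; last exact: ltW.
apply: le_trans (diff_le (B := C1 * P) _ _ _ _) _.
- by move=> i y; apply: derivable_diffs => z; case: sg => /(_ [::]).
- move=> i y; rewrite /partial derive_diffs; last by move=> z; case: sg => /(_ [::]).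
  have [_ H] := HCi i; apply: le_trans (H _ _ lk) _.
  rewrite ler_wpM2r// /C1 (bigD1 i)//= lerDl sumr_ge0// => j _; by case: (HCi j).
rewrite mulrC ler_wpM2l ?enorm_ge0// mulrDl mulrA lerDr !mulr_ge0//.
Qed.

Lemma min1N h : min1 (- h) = min1 h.
Proof. by rewrite /min1 enormN. Qed.

Lemma diffsZ (a : R) (h : 'rV[R]_n -> R) l x :
  diffs l (fun z => a * h z) x = a * diffs l h x.
Proof. by elim: l x => [//|b l IH] x; rewrite !diffsS !IH mulrBr. Qed.

(** A single constant for the orders in use: the fractional gradient takes one difference and the
    fractional Laplacian two, so their composition takes three. *)
Lemma diffs_bound_upto3 (h : 'rV[R]_n -> R) : smooth_bounded h ->
  exists2 K, 0 <= K & forall l x, (0 < size l <= 3)%N ->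
    `|diffs l h x| <= K * \prod_(a <- l) min1 a.
Proof.
move=> sh; have [K1 K10 H1] := diffs_bound 1 sh; have [K2 K20 H2] := diffs_bound 2 sh.
have [K3 K30 H3] := diffs_bound 3 sh.
exists (K1 + K2 + K3); first by rewrite !addr_ge0.
move=> l x; have p0 : 0 <= \prod_(a <- l) min1 a by apply: prodr_ge0 => a _; exact: min1_ge0.
case El: (size l) => [|[|[|[|k]]]]//= _.
- by apply: le_trans (H1 l x El) _; rewrite ler_wpM2r// -addrA lerDl addr_ge0.
- by apply: le_trans (H2 l x El) _; rewrite ler_wpM2r// addrAC lerDr addr_ge0.
- by apply: le_trans (H3 l x El) _; rewrite ler_wpM2r// lerDr addr_ge0.
Qed.

End Differences.

(** * Fractional gradient and Laplacian *)

Section Kernels.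
Context {R : realType} {n : nat}.
Variable s : R.
Hypothesis s01 : 0 < s < 1.
Local Notation domin := (@domin R n s).
Implicit Types (h k x : 'rV[R]_n) (i : 'I_n).

Definition riesz_kernel i k : R := k ord0 i * enorm k `^ (- (n%:R + s + 1)).

Definition lap_kernel h : R := enorm h `^ (- (n%:R + 2 * s)).

Lemma borel_riesz_kernel i : borel_fun (riesz_kernel i).
Proof. by apply: borelM; [exact: borel_coordinate|exact: borel_enorm_powR]. Qed.

Lemma borel_lap_kernel : borel_fun lap_kernel.
Proof. exact: borel_enorm_powR. Qed.

Lemma lap_kernel_ge0 h : 0 <= lap_kernel h.
Proof. exact: powR_ge0. Qed.

Lemma lap_kernelN h : lap_kernel (- h) = lap_kernel h.
Proof. by rewrite /lap_kernel enormN. Qed.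

Lemma enorm_mul_powR h (p : R) : enorm h != 0 -> enorm h * enorm h `^ p = enorm h `^ (p + 1).
Proof. by move=> h0; rewrite powRD ?h0 ?implybT// powRr1 ?enorm_ge0// mulrC. Qed.

(** The kernel has size at most [|k|^(-n-s)], and [min1] gains one power near 0: these are the two
    branches of [domin]. *)
Lemma riesz_kernel_le i k : `|riesz_kernel i k| * min1 k <= domin k.
Proof.
have /andP[s0 s1] := s01.
have [k0|k0] := eqVneq (enorm k) 0.
  by rewrite /min1 k0 (min_r (@ler01 R)) mulr0 domin_ge0.
have H : `|riesz_kernel i k| <= enorm k `^ (- s - n%:R).
  rewrite /riesz_kernel normrM (ger0_norm (powR_ge0 _ _)).
  apply: (@le_trans _ _ (enorm k * enorm k `^ (- (n%:R + s + 1)))).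
    by rewrite ler_wpM2r ?powR_ge0// normr_le_enorm.
  rewrite enorm_mul_powR// (_ : _ + 1 = - s - n%:R)//; lra.
rewrite /domin /min1; case: (leP (enorm k) 1) => k1; last by rewrite mulr1.
apply: le_trans (ler_wpM2r (enorm_ge0 k) H) _.
rewrite mulrC enorm_mul_powR// (_ : _ + 1 = 1 - s - n%:R)//; lra.
Qed.

(* The gain [e ^ (1 - s)] near the origin makes the principal value converge. *)
Lemma lap_kernel_near h (e : R) : e <= 1 -> enorm h <= e ->
  lap_kernel h * min1 h ^+ 2 <= e `^ (1 - s) * domin h.
Proof.
have /andP[s0 s1] := s01 => e1 he.
have [h0|h0] := eqVneq (enorm h) 0.
  by rewrite /min1 h0 (min_r (@ler01 R)) expr0n mulr0 mulr_ge0 ?powR_ge0 ?domin_ge0.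
have h1 := le_trans he e1.
rewrite /domin /min1 h1 (min_r h1) expr2 mulrA mulrC (mulrC (lap_kernel h)).
rewrite /lap_kernel enorm_mul_powR// enorm_mul_powR//.
rewrite (_ : _ + 1 + 1 = (1 - s) + (1 - s - n%:R)); last by lra.
rewrite powRD ?h0 ?implybT// ler_wpM2r ?powR_ge0//.
apply: ge0_ler_powR => //; rewrite ?nnegrE ?enorm_ge0//; first lra.
exact: le_trans (enorm_ge0 h) he.
Qed.

(** There is room at both ends: near 0 the exponent 2 - 2s - n exceeds 1 - s - n, and at infinity -n
    - 2s lies below -n - s. *)
Lemma lap_kernel_le h : lap_kernel h * min1 h ^+ 2 <= domin h.
Proof.
have /andP[s0 s1] := s01.
have [h1|h1] := leP (enorm h) 1.
  by have := lap_kernel_near (lexx 1) h1; rewrite powR1 mul1r.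
rewrite /domin (_ : (enorm h <= 1) = false) /=; last by rewrite leNgt h1.
rewrite /min1 (min_l (ltW h1)) expr1n mulr1.
by rewrite /lap_kernel; apply: ler_powR; [exact: ltW|lra].
Qed.

End Kernels.

(** * Integrals depending on a parameter *)

Section ParametricIntegral.
Context {R : realType} {n : nat}.
Local Notation T := (lm_T (@lebesgue_model R n)).
Local Notation mu := (lm_mu (@lebesgue_model R n)).

Definition borel_fun2 (Phi : 'rV[R]_n -> 'rV[R]_n -> R) :=
  forall d (S : measurableType d) (c1 c2 : S -> 'rV[R]_n),
    (forall i, measurable_fun setT (fun s => c1 s ord0 i)) ->
    (forall i, measurable_fun setT (fun s => c2 s ord0 i)) ->
    measurable_fun setT (fun s => Phi (c1 s) (c2 s)).

Lemma borel_fun2_slice Phi x : borel_fun2 Phi -> borel_fun (Phi x).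
Proof. by move=> bP d S c mc; apply: (bP _ _ (fun=> x)). Qed.

Lemma borel_fun2_pair Phi : borel_fun2 Phi ->
  measurable_fun setT (fun z : T * T => Phi (pt z.1) (pt z.2)).
Proof.
move=> bP; apply: (bP _ _ (fun z : T * T => pt z.1) (fun z => pt z.2)) => i.
  exact: (measurableT_comp (measurable_pt i)).
exact: (measurableT_comp (measurable_pt i)).
Qed.

Lemma borel_rint Phi : borel_fun2 Phi -> borel_fun (fun x => rint (Phi x)).
Proof.
move=> bP d S c mc.
have mI : measurable_fun setT (fun s => \int[mu]_t (Phi (c s) (pt t))%:E)%E.
  apply: (@measurable_integral_param R _ _ S T mu (fun s t => (Phi (c s) (pt t))%:E)).
  apply/measurable_EFinP.
  apply: (bP _ _ (fun z : S * T => c z.1) (fun z => pt z.2)) => i.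
    exact: (measurableT_comp (mc i)).
  exact: (measurableT_comp (measurable_pt i)).
exact: (measurableT_comp (@fine_measurable R setT measurableT) mI).
Qed.

Lemma rint_Fubini Phi (g h : 'rV[R]_n -> R) : borel_fun2 Phi ->
  rv_integrable g -> rv_integrable h -> (forall x, 0 <= g x) -> (forall x, 0 <= h x) ->
  (forall x y, `|Phi x y| <= g x * h y) ->
  rint (fun x => rint (fun y => Phi x y)) = rint (fun y => rint (fun x => Phi x y)).
Proof.
move=> bP ig ih g0 h0 PM.
have bP' : borel_fun2 (fun x y => Phi y x) by move=> d S c1 c2 m1 m2; exact: bP.
have i1 x : rv_integrable (Phi x).
  apply: (rv_integrable_le (borel_fun2_slice x bP) (rv_integrableZ (g x) ih)); exact: PM.
have i2 y : rv_integrable (fun x => Phi x y).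
  apply: (rv_integrable_le (borel_fun2_slice y bP') (rv_integrableZ (h y) ig)) => x.
  by rewrite mulrC; exact: PM.
have mP : measurable_fun setT (fun z : T * T => (Phi (pt z.1) (pt z.2))%:E).
  by apply/measurable_EFinP; exact: borel_fun2_pair.
have iP : (mu \x mu)%E.-integrable setT (fun z : T * T => (Phi (pt z.1) (pt z.2))%:E).
  apply/integrable12ltyP => //=.
  apply: (@le_lt_trans _ _ (\int[mu]_t (rint h * g (pt t))%:E)%E); last first.
    by rewrite (rintE (rv_integrableZ (rint h) ig)) ltry.
  apply: ge0_le_integral => //.
  - by move=> t _; apply: integral_ge0.
  - apply: (@measurable_integral_param R _ _ T T mu (fun t y => `|(Phi (pt t) (pt y))%:E|%E)).
    exact: measurableT_comp.
  - by have /measurable_int := rv_integrableZ (rint h) ig.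
  - move=> t _; rewrite mulrC -rintZ// -(rintE (rv_integrableZ (g (pt t)) ih)).
    apply: ge0_le_integral => //.
    + apply/measurable_EFinP; apply: (measurableT_comp (@normr_measurable R setT)).
      exact: (measurable_borel (borel_fun2_slice (pt t) bP)).
    + by have /measurable_int := rv_integrableZ (g (pt t)) ih.
    + by move=> y _; rewrite lee_fin.
have := Fubini iP; rewrite /= /rint /Rintegral => H.
congr fine; rewrite -[LHS]/(\int[mu]_t (rint (Phi (pt t)))%:E)%E.
rewrite -[RHS]/(\int[mu]_t (rint (fun x => Phi x (pt t)))%:E)%E.
under eq_integral do rewrite -(rintE (i1 _)).
by rewrite H; apply: eq_integral => t _; rewrite -(rintE (i2 _)).
Qed.

End ParametricIntegral.

(** * The two operators as absolutely convergent integrals *)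

Section Operators.
Context {R : realType} {n : nat}.
Variables (s : R) (u : 'rV[R]_n -> R) (K : R).
Hypotheses (n_gt0 : (0 < n)%N) (s01 : 0 < s < 1) (cu : continuous u).
Hypotheses (K_ge0 : 0 <= K)
  (uK : forall l x, (0 < size l <= 3)%N -> `|diffs l u x| <= K * \prod_(a <- l) min1 a).
Local Notation domin := (@domin R n s).
Local Notation riesz_kernel := (@riesz_kernel R n s).
Local Notation lap_kernel := (@lap_kernel R n s).
Implicit Types (h k x : 'rV[R]_n) (i : 'I_n).

Local Notation Dom := (rint domin).

(** Increments serve as integration variables, hence a list [ls] of functions of the sample point.
    The default [fun=> 0] makes the condition trivial beyond the end of the list. *)
Lemma measurable_diffs d (S : measurableType d) (ls : seq (S -> 'rV[R]_n)) (c : S -> 'rV[R]_n) :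
  (forall j i, measurable_fun setT (fun z => nth (fun=> 0) ls j z ord0 i)) ->
  (forall i, measurable_fun setT (fun z => c z ord0 i)) ->
  measurable_fun setT (fun z => diffs [seq a z | a <- ls] u (c z)).
Proof.
elim: ls c => [|a ls IH] c mls mc; first exact: (borel_continuous cu mc).
apply: measurable_funB; last by apply: IH => // j i; exact: (mls j.+1).
apply: IH => [j i|i]; first exact: (mls j.+1).
under eq_fun do rewrite mxE.
by apply: measurable_funD => //; exact: (mls 0%N).
Qed.

Definition riesz_grad i x : R := rint (fun k => riesz_kernel i k * diffs [:: k] u x).

(* Up to the factor [- Cns / 2], the fractional Laplacian of [u]. *)
Definition second_diff_lap x : R := rint (fun h => lap_kernel h * diffs [:: h; h] u (x - h)).

Lemma borel_riesz_grad_integrand i l : borel_fun2 (fun x k => riesz_kernel i k * diffs (rcons l k) u x).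
Proof.
move=> d S c1 c2 m1 m2; apply: measurable_funM; first exact: (borel_riesz_kernel s i m2).
rewrite (_ : (fun _ => _) = fun z => diffs [seq a z | a <- rcons [seq (fun=> b) | b <- l] c2] u (c1 z)); last first.
  by apply/funext => z; rewrite map_rcons -map_comp map_id.
apply: measurable_diffs => // j i'.
rewrite nth_rcons size_map; case: ltnP => [jl|_].
  by rewrite (nth_map 0).
by case: eqP.
Qed.

Lemma riesz_grad_integrand_le i l x k : (size l <= 2)%N ->
  `|riesz_kernel i k * diffs (rcons l k) u x| <= K * (\prod_(a <- l) min1 a) * domin k.
Proof.
move=> l2; rewrite normrM.
apply: le_trans (ler_wpM2l (normr_ge0 _) (uK _ _)) _; first by rewrite size_rcons.
rewrite big_rcons/=; set P := \prod_(_ <- _) _.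
have P0 : 0 <= P by apply: prodr_ge0 => a _; exact: min1_ge0.
rewrite [leLHS](_ : _ = K * P * (`|riesz_kernel i k| * min1 k)); last by ring.
by rewrite ler_wpM2l ?mulr_ge0//; exact: riesz_kernel_le.
Qed.

Lemma riesz_grad_integrable i l x : (size l <= 2)%N ->
  rv_integrable (fun k => riesz_kernel i k * diffs (rcons l k) u x).
Proof.
move=> l2; apply: (rv_integrable_dom n_gt0 s01 _ (fun k => riesz_grad_integrand_le i x k l2)).
exact: (borel_fun2_slice x (borel_riesz_grad_integrand i l)).
Qed.

(** Differences pass under the integral by linearity alone, which is the advantage of measuring
    regularity by differences rather than derivatives. *)
Lemma diffs_riesz_grad i l x : (size l <= 2)%N ->
  diffs l (riesz_grad i) x = rint (fun k => riesz_kernel i k * diffs (rcons l k) u x).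
Proof.
elim: l x => [//|a l IH] x l2; rewrite diffsS !IH ?(ltnW l2)//.
rewrite -rintB; try by apply: riesz_grad_integrable; exact: ltnW.
by apply: eq_rint => k; rewrite rcons_cons diffsS mulrBr.
Qed.

Lemma riesz_grad_le i l x : (size l <= 2)%N ->
  `|diffs l (riesz_grad i) x| <= K * (\prod_(a <- l) min1 a) * Dom.
Proof.
move=> l2; rewrite diffs_riesz_grad//.
apply: (rint_dom_le n_gt0 s01 _ (fun k => riesz_grad_integrand_le i x k l2)).
exact: (borel_fun2_slice x (borel_riesz_grad_integrand i l)).
Qed.

Lemma borel_riesz_grad i : borel_fun (riesz_grad i).
Proof. by apply: borel_rint; exact: (borel_riesz_grad_integrand i [::]). Qed.

Lemma borel_second_diff_integrand l :
  borel_fun2 (fun x h => lap_kernel h * diffs (l ++ [:: h; h]) u (x - h)).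
Proof.
move=> d S c1 c2 m1 m2; apply: measurable_funM; first exact: (borel_lap_kernel s m2).
rewrite (_ : (fun _ => _) = fun z => diffs [seq a z | a <- [seq (fun=> b) | b <- l] ++ [:: c2; c2]] u (c1 z - c2 z)); last first.
  by apply/funext => z; rewrite map_cat -map_comp map_id.
apply: measurable_diffs => [j i|i]; last first.
  under eq_fun do rewrite !mxE.
  exact: measurable_funB.
rewrite nth_cat size_map; case: ltnP => [jl|_].
  by rewrite (nth_map 0).
case: (j - _)%N => [|[|m]]; [exact: m2|exact: m2|rewrite /= nth_nil; exact: measurable_cst].
Qed.

Lemma second_diff_integrand_le l x h : (size l <= 1)%N ->
  `|lap_kernel h * diffs (l ++ [:: h; h]) u (x - h)| <= K * (\prod_(a <- l) min1 a) * domin h.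
Proof.
move=> l1; rewrite normrM (ger0_norm (lap_kernel_ge0 _ _)).
apply: le_trans (ler_wpM2l (lap_kernel_ge0 _ _) (uK _ _)) _; first by rewrite size_cat addn2.
rewrite big_cat/= !big_cons big_nil mulr1; set P := \prod_(_ <- _) _.
have P0 : 0 <= P by apply: prodr_ge0 => a _; exact: min1_ge0.
rewrite [leLHS](_ : _ = K * P * (lap_kernel h * min1 h ^+ 2)); last by ring.
by rewrite ler_wpM2l ?mulr_ge0//; exact: lap_kernel_le.
Qed.

Lemma second_diff_integrable l x : (size l <= 1)%N ->
  rv_integrable (fun h => lap_kernel h * diffs (l ++ [:: h; h]) u (x - h)).
Proof.
move=> l1; apply: (rv_integrable_dom n_gt0 s01 _ (fun h => second_diff_integrand_le x h l1)).
exact: (borel_fun2_slice x (borel_second_diff_integrand l)).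
Qed.

Lemma borel_second_diff_lap : borel_fun second_diff_lap.
Proof. by apply: borel_rint; exact: (borel_second_diff_integrand [::]). Qed.

Lemma diff_second_diff_lap k x :
  diff k second_diff_lap x = rint (fun h => lap_kernel h * diffs [:: k; h; h] u (x - h)).
Proof.
rewrite /diff /second_diff_lap -rintB; try exact: (@second_diff_integrable [::] _ isT).
by apply: eq_rint => h; rewrite -mulrBr (addrAC x k).
Qed.

Lemma diff_second_diff_lap_le k x : `|diff k second_diff_lap x| <= K * min1 k * Dom.
Proof.
rewrite diff_second_diff_lap.
have H h := second_diff_integrand_le (l := [:: k]) x h isT.
have := rint_dom_le n_gt0 s01 (borel_fun2_slice x (borel_second_diff_integrand [:: k])) H.
by rewrite big_cons big_nil mulr1.
Qed.

(** The substitution [y = x + k]. The cancellation in [u y - u x] makes the integral absolutely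
    convergent, so the iterated integral agrees with the one over the model. *)
Lemma frac_partialE i x : frac_partial s u i x = mu_ns n s * riesz_grad i x.
Proof.
rewrite /frac_partial; congr (_ * _).
pose Psi k := riesz_kernel i k * diffs [:: k] u x.
have bPsi : borel_fun Psi := borel_fun2_slice x (borel_riesz_grad_integrand i [::]).
have iPsi : rv_integrable Psi by exact: (@riesz_grad_integrable i [::] x isT).
rewrite (_ : (fun y => _) = fun y => (Psi (1 *: y + (- x)))%:E); last first.
  apply/funext => y; rewrite scale1r /Psi /riesz_kernel !mxE powRN/= /diff.
  by rewrite [x + _]addrC subrK mulrAC.
rewrite (intRn_integrable (g := fun y => Psi (1 *: y - x))).
- rewrite integral_pt_affine1 ?normr1//; by rewrite (rintE iPsi).
- exact: borel_affine_fun.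
- by apply: integrable_pt_affine1; rewrite ?normr1.
Qed.

Lemma borel_second_diff_trunc (e : R) x : borel_fun (fun h => if e <= enorm h
  then lap_kernel h * diffs [:: h; h] u (x - h) else 0).
Proof.
apply: borel_ifle; [exact: borel_cst|exact: borel_enorm| |exact: borel_cst].
exact: (borel_fun2_slice x (borel_second_diff_integrand [::])).
Qed.

Lemma second_diff_trunc_integrable (e : R) x : rv_integrable (fun h => if e <= enorm h
  then lap_kernel h * diffs [:: h; h] u (x - h) else 0).
Proof.
apply: (rv_integrable_dom (C := K) n_gt0 s01); first exact: borel_second_diff_trunc.
move=> h; case: ifP => _; last by rewrite normr0 mulr_ge0 ?domin_ge0.
by have := @second_diff_integrand_le [::] x h isT; rewrite big_nil mulr1.
Qed.

(** The truncated integral converges absolutely, so it may be averaged with its image under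
    [h -> - h]. This produces the symmetric second difference [u (x + h) - 2 u x + u (x - h)], which
    is [diffs [:: h; h] u (x - h)]. *)
Lemma second_diff_truncE (e : R) x : 0 < e ->
  frac_lap_trunc s u e x = (- (2^-1 * rint (fun h => if e <= enorm h
     then lap_kernel h * diffs [:: h; h] u (x - h) else 0)))%:E.
Proof.
move=> e0.
pose Psi h := if e <= enorm h then - (lap_kernel h * diffs [:: h] u x) else 0.
have bdiff : borel_fun (fun h => diffs [:: h] u x).
  move=> d S c mc; apply: (@measurable_diffs _ _ [:: c] (fun=> x)) => // -[|[|j]] i //=.
have bPsi : borel_fun Psi.
  apply: borel_ifle; [exact: borel_cst|exact: borel_enorm| |exact: borel_cst].
  rewrite (_ : (fun h => _) = fun h => 0 - lap_kernel h * diffs [:: h] u x); last first.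
    by apply/funext => h; rewrite sub0r.
  by apply: borelB; [exact: borel_cst|apply: borelM => //; exact: borel_lap_kernel].
have m0 : 0 < Num.min 1 e by rewrite lt_min ltr01.
(* A first difference supplies only one factor [min1 h]; on [e <= enorm h] the bound
   [Num.min 1 e <= min1 h] pays for the second one. *)
have Psi_le h : `|Psi h| <= (K / Num.min 1 e) * domin h.
  rewrite /Psi; case: ifPn => [eh|_]; last first.
    by rewrite normr0 mulr_ge0 ?domin_ge0// divr_ge0// ltW.
  rewrite normrN normrM (ger0_norm (lap_kernel_ge0 _ _)).
  apply: le_trans (ler_wpM2l (lap_kernel_ge0 _ _) (uK _ _)) _ => //.
  rewrite big_cons big_nil mulr1 mulrCA -[leRHS]mulrA ler_wpM2l// ler_pdivlMl//.
  apply: le_trans _ (lap_kernel_le s01 h).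
  rewrite mulrCA ler_wpM2l ?lap_kernel_ge0// expr2 ler_wpM2r ?min1_ge0//.
  by rewrite /min1 le_min !ge_min lexx/= eh orbT.
have iPsi : rv_integrable Psi := rv_integrable_dom n_gt0 s01 bPsi Psi_le.
rewrite /frac_lap_trunc (_ : (fun y => _) = fun y => (Psi (1 *: y + (- x)))%:E); last first.
  apply/funext => y; rewrite scale1r /Psi -enormN opprB; case: ifP => // _.
  by rewrite /lap_kernel powRN/= /diff [x + _]addrC subrK -mulNr mulrC mulNr -mulrN opprB.
rewrite (intRn_integrable (g := fun y => Psi (1 *: y - x))); last 2 first.
- exact: borel_affine_fun.
- by apply: integrable_pt_affine1; rewrite ?normr1.
rewrite integral_pt_affine1 ?normr1// (rintE iPsi); congr EFin.
have iPsiN : rv_integrable (fun h => Psi (-1 *: h + 0)).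
  by apply: integrable_pt_affine1; rewrite ?normrN1.
have E : rint Psi = 2^-1 * (rint Psi + rint (fun h => Psi (-1 *: h + 0))).
  by rewrite rint_affine1 ?normrN1//; field.
rewrite E -rintD// -mulrN; congr (_ * _).
rewrite -[RHS]mulN1r -rintZ.
  apply: eq_rint => h; rewrite /Psi addr0 scaleN1r enormN lap_kernelN.
  case: ifP => _; rewrite ?addr0 ?mulr0//= /diff addrNK.
  by ring.
exact: second_diff_trunc_integrable.
Qed.

(** The second difference is integrable against [lap_kernel] up to the origin, and truncating at [e]
    changes the integral by at most [K * Dom] times [e^(1 - s)], which tends to 0. *)
Lemma frac_lapE x : frac_lap s u x = Cns n s * (- (2^-1 * second_diff_lap x)).
Proof.
have /andP[s0 s1] := s01.
congr (_ * _); apply: cvg_lim => //.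
apply/cvgrPdist_lt => d d0.
have D0 : 0 <= Dom by apply: rint_ge0 => h; exact: domin_ge0.
(* [e0] solves [e0^(1 - s) (K Dom + 1) = d]; the [+ 1] keeps the denominator positive. *)
pose e0 : R := (d / (K * Dom + 1)) `^ (1 - s)^-1.
have B0 : 0 < K * Dom + 1 by rewrite ltr_wpDl ?mulr_ge0.
have e00 : 0 < e0 by rewrite powR_gt0// divr_gt0.
near=> e.
have e_gt0 : 0 < e by near: e; exact: nbhs_right_gt.
have e_lt1 : e < 1 by near: e; exact: nbhs_right_lt.
have e_lt0 : e < e0 by near: e; exact: nbhs_right_lt.
rewrite second_diff_truncE//= opprK addrC -mulrBr -rintB; last 2 first.
- exact: second_diff_trunc_integrable.
- exact: (@second_diff_integrable [::] _ isT).
rewrite normrM ger0_norm ?invr_ge0//.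
have H h : `|(if e <= enorm h then lap_kernel h * diffs [:: h; h] u (x - h) else 0) -
    lap_kernel h * diffs [:: h; h] u (x - h)| <= K * e `^ (1 - s) * domin h.
  case: (leP e (enorm h)) => eh.
    by rewrite subrr normr0 !mulr_ge0 ?powR_ge0 ?domin_ge0.
  rewrite sub0r normrN normrM (ger0_norm (lap_kernel_ge0 _ _)).
  apply: le_trans (ler_wpM2l (lap_kernel_ge0 _ _) (uK _ _)) _ => //.
  rewrite !big_cons big_nil mulr1 -mulrA mulrCA ler_wpM2l// -expr2.
  apply: lap_kernel_near => //; exact: ltW.
have {}H := rint_dom_le n_gt0 s01 _ H.
apply: (@le_lt_trans _ _ (2^-1 * (K * e `^ (1 - s) * Dom))).
  rewrite ler_wpM2l ?invr_ge0//; apply: H; apply: borelB; last first.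
    exact: (borel_fun2_slice x (borel_second_diff_integrand [::])).
  exact: borel_second_diff_trunc.
have H2 : e `^ (1 - s) * (K * Dom + 1) < d.
  rewrite -ltr_pdivlMr//.
  have -> : d / (K * Dom + 1) = e0 `^ (1 - s).
    by rewrite /e0 -powRrM mulVf ?powRr1// ?ltW ?divr_gt0// subr_eq0 gt_eqF.
  apply: gt0_ltr_powR; rewrite ?nnegrE ?subr_gt0// ltW//.
have := powR_ge0 e (1 - s); have : 0 <= e `^ (1 - s) * (K * Dom) by rewrite !mulr_ge0 ?powR_ge0.
by move: H2; nra.
Unshelve. all: by end_near.
Qed.

(* (-Delta)^s and grad^s commute: both are absolutely convergent integrals of
   third differences of [u]. *)
Lemma frac_partial_frac_lap i :
  frac_partial s (frac_lap s u) i 0 =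
  mu_ns n s * (- (Cns n s * 2^-1)) *
    rint (fun h => lap_kernel h * diffs [:: h; h] (riesz_grad i) (- h)).
Proof.
rewrite /frac_partial -mulrA; congr (_ * _).
set c := Cns n s * 2^-1.
have fE x : frac_lap s u x = - c * second_diff_lap x by rewrite frac_lapE /c; ring.
pose Psi k := riesz_kernel i k * diff k second_diff_lap 0.
have Psi_le k : `|Psi k| <= K * Dom * domin k.
  rewrite /Psi normrM; apply: le_trans (ler_wpM2l (normr_ge0 _) (diff_second_diff_lap_le _ _)) _.
  rewrite [leLHS](_ : _ = K * Dom * (`|riesz_kernel i k| * min1 k)); last by ring.
  rewrite ler_wpM2l ?riesz_kernel_le// mulr_ge0// rint_ge0// => h; exact: domin_ge0.
have bPsi : borel_fun Psi.
  apply: borelM; first exact: borel_riesz_kernel.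
  apply: borelB; last exact: borel_cst.
  have := borel_affine_fun 1 0 borel_second_diff_lap.
  by under eq_fun do rewrite scale1r addrC.
have iPsi : rv_integrable Psi := rv_integrable_dom n_gt0 s01 bPsi Psi_le.
rewrite (_ : (fun y => _) = fun y => (- c * Psi y)%:E); last first.
  apply/funext => y; rewrite subr0 mxE subr0 !fE /Psi /riesz_kernel powRN /diff add0r.
  by congr EFin; ring.
rewrite (intRn_integrable (g := fun y => - c * Psi y)); last 2 first.
- by apply: borelM => //; exact: borel_cst.
- exact: rv_integrableZ.
rewrite (rintE (rv_integrableZ (- c) iPsi)) -[LHS]/(rint (fun y => - c * Psi y)) rintZ//.
congr (_ * _).
transitivity (rint (fun k => rint (fun h => riesz_kernel i k * (lap_kernel h * diffs [:: k; h; h] u (- h))))).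
  apply: eq_rint => k; rewrite /Psi diff_second_diff_lap -rintZ.
    by apply: eq_rint => h; rewrite sub0r.
  exact: (@second_diff_integrable [:: k] _ isT).
transitivity (rint (fun h => rint (fun k => riesz_kernel i k * (lap_kernel h * diffs [:: k; h; h] u (- h))))); last first.
  apply: eq_rint => h; rewrite diffs_riesz_grad// -rintZ; last exact: (@riesz_grad_integrable i [:: h; h] _ isT).
  apply: eq_rint => k; rewrite mulrCA; congr (_ * (_ * _)).
  (* The increments commute: [[:: k; h; h]] and [[:: h; h; k]] give the same difference. *)
  rewrite /= /diff.
  by rewrite !(addrAC _ k h) !addNr !add0r; ring.
(* The third difference is at most [K * min1 k * min1 h ^+ 2]: each kernel receives the factor it
   needs, and the majorant separates into a function of [k] and one of [h]. *)
apply: (rint_Fubini (g := fun k => K * domin k) (h := domin)).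
- move=> d S c1 c2 m1 m2; apply: measurable_funM; first exact: borel_riesz_kernel.
  apply: measurable_funM; first exact: borel_lap_kernel.
  apply: (@measurable_diffs _ _ [:: c1; c2; c2] (fun z => - c2 z)) => [j i'|i'].
    by case: j => [|[|[|j]]]; [exact: m1|exact: m2|exact: m2|rewrite /= nth_nil; exact: measurable_cst].
  by under eq_fun do rewrite mxE; exact: measurable_funN.
- exact: rv_integrableZ (integrable_domin n_gt0 s01).
- exact: integrable_domin.
- by move=> k; rewrite mulr_ge0 ?domin_ge0.
- by move=> h; exact: domin_ge0.
move=> k h; rewrite normrM [X in _ * X]normrM (ger0_norm (lap_kernel_ge0 _ _)).
have /(_ isT) H := uK (- h) (l := [:: k; h; h]).
apply: le_trans (ler_wpM2l (normr_ge0 _) (ler_wpM2l (lap_kernel_ge0 _ _) H)) _.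
rewrite !big_cons big_nil mulr1.
rewrite [leLHS](_ : _ = K * ((`|riesz_kernel i k| * min1 k) * (lap_kernel h * min1 h ^+ 2))); last by ring.
rewrite -[leRHS]mulrA ler_wpM2l// ler_pM ?mulr_ge0 ?min1_ge0 ?lap_kernel_ge0 ?exprn_ge0 ?min1_ge0//.
  exact: riesz_kernel_le.
exact: lap_kernel_le.
Qed.

End Operators.

(** * Positivity of the normalizing constant *)

Section NormalizingConstant.
Context {R : realType} {n : nat}.
Variable s : R.
Hypotheses (n_gt0 : (0 < n)%N) (s01 : 0 < s < 1).

Lemma sin_le (t : R) : 0 <= t -> sin t <= t.
Proof.
rewrite le_eqVlt => /orP[/eqP <-|t0]; first by rewrite sin0.
have [c _] := MVT t0 (fun x _ => is_derive_sin x)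
  (continuous_subspaceT (@continuous_sin R)).
rewrite sin0 !subr0 => ->.
by rewrite -[leRHS]mul1r ler_wpM2r ?cos_le1// ltW.
Qed.

Lemma one_sub_cos (t : R) : 1 - cos t = 2 * sin (t / 2) ^+ 2.
Proof.
have {1}-> : t = (t / 2) *+ 2 by rewrite -mulr_natr divfK.
by rewrite cos_mulr2n cos2sin2; ring.
Qed.

Lemma one_sub_cos_le (h : 'rV[R]_n) i : 1 - cos (h ord0 i) <= 2 * min1 h ^+ 2.
Proof.
rewrite one_sub_cos ler_wpM2l// -real_normK ?num_real//.
rewrite lerXn2r ?nnegrE ?min1_ge0// /min1 le_min.
apply/andP; split; first by rewrite ler_norml sin_geN1 sin_le1.
apply: le_trans (normr_le_enorm h i).
have H (t : R) : 0 <= t -> `|sin (t / 2)| <= t.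
  move=> t0; rewrite ler_norml; apply/andP; split; last first.
    by apply: le_trans (sin_le _) _; rewrite ?divr_ge0// ler_pdivrMr//; lra.
  have [t1|t1] := leP t 1; last by apply: le_trans (sin_geN1 _); lra.
  apply: (@le_trans _ _ 0); first lra.
  apply: sin_ge0_pi; rewrite divr_ge0//= ler_pdivrMr//.
  by have := pi_ge2 R; lra.
have [h0|h0] := leP 0 (h ord0 i); first by rewrite [leRHS]ger0_norm// H.
rewrite [leRHS]ltr0_norm// -normrN -sinN -mulNr H//; lra.
Qed.

(** Needed to read off a sign from the hypothesis at the origin. Under [fine] and inversion, an
    infinite or a vanishing integral would both give 0. Finiteness follows from [1 - cos] being
    quadratically small; vanishing would make the integrand zero almost everywhere. *)
Lemma Cns_gt0 : 0 < Cns n s.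
Proof.
have /andP[s0 s1] := s01.
pose i0 : 'I_n := Ordinal n_gt0.
pose g (h : 'rV[R]_n) := (1 - cos (h ord0 i0)) * lap_kernel s h.
have g0 h : 0 <= g h by rewrite mulr_ge0 ?lap_kernel_ge0// subr_ge0 cos_le1.
have bg : borel_fun g.
  apply: borelM; last exact: borel_lap_kernel.
  apply: borelB; first exact: borel_cst.
  have mcos : measurable_fun setT (@cos R) by apply: continuous_measurable_fun; exact: continuous_cos.
  exact: (borel_comp (borel_coordinate i0) mcos).
have ig : rv_integrable g.
  apply: (rv_integrable_dom (C := 2) n_gt0 s01 bg) => h.
  rewrite ger0_norm//; apply: le_trans (ler_wpM2r (lap_kernel_ge0 _ _) (one_sub_cos_le h i0)) _.
  by rewrite -mulrA ler_wpM2l// mulrC lap_kernel_le.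
have -> : Cns n s = (rint g)^-1.
  rewrite /Cns; congr (_^-1).
  rewrite -[RHS]/(fine (rint g)%:E) -(rintE ig) -(intRn_ge0 bg g0); congr fine.
  rewrite /intRn; congr iint; apply/funext => z.
  by rewrite /g /lap_kernel mxE powRN.
rewrite invr_gt0 lt_neqAle rint_ge0// andbT; apply/eqP => I0.
(* The product of [chi] over the coordinates is the indicator of the cube [1, 2]^n, of measure 1, on
   which the integrand is positive. *)
pose chi (t : R) : R := if 1 <= t then (if t <= 2 then 1 else 0) else 0.
have mchi : measurable_fun setT chi.
  by apply: measurable_fun_ifT => //; [exact: measurable_fun_ler|apply: measurable_fun_ifT => //; exact: measurable_fun_ler].
have chi0 t : 0 <= chi t by rewrite /chi; do 2 case: ifP => // _.
have := integral_pt_prod n mchi chi0.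
have -> : (\int[@lebesgue_measure R]_t (chi t)%:E = 1)%E.
  transitivity (\int[@lebesgue_measure R]_(t in `[1%R, 2%R]) (1%:E))%E.
    rewrite [RHS]integral_mkcond; apply: eq_integral => t _.
    rewrite /chi patchE; have [|] := boolP (t \in `[1, 2]%classic).
      by rewrite inE/= in_itv/= => /andP[-> ->].
    rewrite notin_setE/= in_itv/= => /negP.
    by case: (1 <= t) => //=; case: (t <= 2).
  rewrite integral_cst//= lebesgue_measure_itv/= lte_fin ltr1n mul1e -EFinB.
  by congr EFin; ring.
rewrite -EFin_expe expr1n.
have /(ae_eq_integral_abs (lm_mu (@lebesgue_model R n)) measurableT) : measurable_fun setT (fun t => (g (pt t))%:E).
  by apply/measurable_EFinP; exact: (measurable_borel bg).
move=> [H _]; have {}H : ae_eq (lm_mu (@lebesgue_model R n)) setT (fun t => (g (pt t))%:E) (cst 0%E).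
  apply: H; under eq_integral do rewrite /= ger0_norm//.
  by rewrite (rintE ig) -I0.
rewrite (@ae_eq_integral _ _ _ _ _ (cst 0%E))//.
- by rewrite integral0 => -[/eqP]; rewrite eq_sym oner_eq0.
- apply/measurable_EFinP; apply: measurable_prod => i _.
  by apply: (measurableT_comp mchi); exact: measurable_pt.
move: H; apply: filterS => t /(_ I) /= [gt0] _; congr EFin.
have [ht|] := boolP ((1 <= pt t ord0 i0) && (pt t ord0 i0 <= 2)); last first.
  move=> Hn; rewrite (bigD1 i0)//= {1}/chi.
  by move: Hn; case: (1 <= _) => //=; rewrite ?mul0r// => /negbTE ->; rewrite mul0r.
exfalso; have /andP[t1 t2] := ht.
move: gt0; apply/eqP; rewrite mulf_neq0//.
  rewrite one_sub_cos mulf_neq0// expf_neq0// gt_eqF// sin_gt0_pi//.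
  by have := pi_ge2 R; lra.
rewrite gt_eqF// powR_gt0//; apply: lt_le_trans (normr_le_enorm _ i0).
by rewrite normr_gt0 gt_eqF//; lra.
Qed.

End NormalizingConstant.

(** * Mean values of the squared gradient *)

Section MeanKernel.
Context {R : realType} {n : nat}.
Variable s : R.
Hypotheses (n_gt0 : (0 < n)%N) (s01 : 0 < s < 1).
Local Notation domin := (@domin R n s).
Local Notation lap_kernel := (@lap_kernel R n s).
Local Notation leb := (@lebesgue_measure R).
Local Notation mu := (lm_mu (@lebesgue_model R n)).
Local Notation T := (lm_T (@lebesgue_model R n)).
Implicit Types z : 'rV[R]_n.

(* [Kernel s r] without the factors [a_ns n s] and [r ^ (2 s)]. *)
Definition mean_kernel (r : R) z : R :=
  if r < enorm z then (enorm z ^+ 2 - r ^+ 2) `^ (- s) * enorm z `^ (- n%:R) else 0.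

Lemma mean_kernel_ge0 r z : 0 <= mean_kernel r z.
Proof. by rewrite /mean_kernel; case: ifP => // _; rewrite mulr_ge0 ?powR_ge0. Qed.

Lemma mean_kernelN r z : mean_kernel r (- z) = mean_kernel r z.
Proof. by rewrite /mean_kernel enormN. Qed.

Lemma mean_kernelZ r z : 0 < r ->
  mean_kernel r z = r `^ (- (2 * s) - n%:R) * mean_kernel 1 (r^-1 *: z).
Proof.
move=> r0; have ri0 : 0 < r^-1 by rewrite invr_gt0.
rewrite /mean_kernel enormZ gtr0_norm// (mulrC r^-1) ltr_pdivlMr// mul1r.
case: ifP => rz; last by rewrite mulr0.
have z0 := lt_trans r0 rz.
have [a za] : exists a, enorm z = r * a.
  by exists (enorm z / r); rewrite mulrCA divff ?mulr1// gt_eqF.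
rewrite za (mulrC r a) mulfK ?gt_eqF//.
have a1 : 1 <= a by rewrite -(ler_pM2l r0) mulr1 -za ltW.
have a0 : 0 <= a := le_trans ler01 a1.
have -> : (a * r) ^+ 2 - r ^+ 2 = r ^+ 2 * (a ^+ 2 - 1 ^+ 2) by ring.
rewrite (@powRM _ (r ^+ 2)) ?sqr_ge0//; last by rewrite expr1n subr_ge0 expr_ge1.
rewrite (@powRM _ a r) ?(ltW r0)//.
rewrite (_ : r `^ (- (2 * s) - n%:R) = (r ^+ 2) `^ (- s) * r `^ (- n%:R)); first by ring.
by rewrite powRD ?(gt_eqF r0) ?implybT// -powR_mulrn ?(ltW r0)// -powRrM mulrN.
Qed.

Lemma borel_mean_kernel r : borel_fun (mean_kernel r).
Proof.
apply: borel_iflt; [exact: borel_cst|exact: borel_enorm| |exact: borel_cst].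
apply: borelM; last exact: borel_enorm_powR.
have m : measurable_fun setT (fun x : R => (x ^+ 2 - r ^+ 2) `^ (- s)).
  apply: (measurableT_comp (measurable_powR _)).
  by apply: measurable_funB => //; exact: measurable_funX.
exact: (borel_comp borel_enorm m).
Qed.

(** From [|z|^2 - r^2 >= |z| (|z| - r)]: the factor [|z|^(-s)] gives the decay of [domin] at
    infinity, and the singularity on the sphere becomes a power of the distance [|z| - r]. *)
Lemma mean_kernel_le r z : 1 <= r -> r < enorm z ->
  mean_kernel r z <= domin z * (enorm z - r) `^ (- s).
Proof.
move=> r1 rz; have /andP[s0 s1] := s01.
have z1 : 1 < enorm z := le_lt_trans r1 rz.
have z0 : 0 < enorm z := lt_trans ltr01 z1.
rewrite /mean_kernel rz /domin (_ : (enorm z <= 1) = false); last by rewrite leNgt z1.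
rewrite (_ : enorm z `^ (- s - n%:R) = enorm z `^ (- s) * enorm z `^ (- n%:R)); last first.
  by rewrite powRD// (gt_eqF z0) implybT.
rewrite [leRHS]mulrAC ler_wpM2r ?powR_ge0//.
rewrite -powRM ?subr_ge0 ?(ltW rz) ?(ltW z0)//.
have rz0 : 0 < enorm z - r by rewrite subr_gt0.
apply: powR_le_neg; first by rewrite mulr_gt0.
  by nra.
by rewrite oppr_le0 ltW.
Qed.

Lemma measurable_mean_kernel d (S : measurableType d) (rho : S -> R) (c : S -> 'rV[R]_n) :
  measurable_fun setT rho -> (forall i, measurable_fun setT (fun x => c x ord0 i)) ->
  measurable_fun setT (fun x => mean_kernel (rho x) (c x)).
Proof.
move=> mr mc.
have mn : measurable_fun setT (fun x => enorm (c x)) := borel_enorm mc.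
apply: measurable_fun_ifT => //; first exact: measurable_fun_ltr.
apply: measurable_funM; last exact: (measurableT_comp (measurable_powR _) mn).
apply: (measurableT_comp (measurable_powR _)).
by apply: measurable_funB; exact: measurable_funX.
Qed.

(** As a function of [r], the power of [|z| - r] is integrable: where the distance is at most 1 it
    contributes at most the integral of [t^(-s)] over (0, 1], namely [(1 - s)^-1], and elsewhere it
    is at most 1 on an interval of length 1. *)
Lemma integral_mean_kernel_radius z :
  (\int[leb]_(r in `[1%R, 2%R]) (mean_kernel r z)%:E <= (domin z * ((1 - s)^-1 + 1))%:E)%E.
Proof.
have /andP[s0 s1] := s01.
have s1' : 0 < 1 - s by rewrite subr_gt0.
pose psi : R -> \bar R := (fun t => (t `^ ((1 - s) - 1))%:E) \_ `]0, 1].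
have mpsi : measurable_fun setT psi.
  by apply/(measurable_restrictT _ _).1 => //; exact: measurable_powR_EFin.
have psi0 t : (0 <= psi t)%E by apply: erestrict_ge0 => x _; rewrite lee_fin powR_ge0.
have Ipsi : (\int[leb]_t psi t <= ((1 - s)^-1)%:E)%E.
  rewrite /psi -integral_mkcond; apply: le_trans (integral_powR_le ltr01 s1') _.
  by rewrite powR1 mul1r.
have mpsi' : measurable_fun setT (fun r : R => psi (- 1 * r + enorm z)).
  apply: (measurableT_comp mpsi); apply: measurable_funD => //; exact: measurable_funM.
have D0 := domin_ge0 s z.
apply: (@le_trans _ _ (\int[leb]_(r in `[1%R, 2%R]) ((domin z)%:E * (psi (- 1 * r + enorm z)%R + 1))))%E.
  apply: ge0_le_integral => //.
  - by move=> r _; rewrite lee_fin mean_kernel_ge0.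
  - apply/measurable_EFinP; apply: (measurable_funS measurableT) => //.
    exact: (measurable_mean_kernel (rho := id) (c := fun=> z)).
  - apply: (measurable_funS measurableT) => //.
    by apply: measurable_funeM; exact: emeasurable_funD.
  - move=> r; rewrite /= in_itv/= => /andP[r1 _].
    have [rz|rz] := ltP r (enorm z); last first.
      rewrite /mean_kernel (_ : (r < enorm z) = false); last by rewrite ltNge rz.
      by rewrite mule_ge0 ?lee_fin// adde_ge0.
    apply: (@le_trans _ _ ((domin z)%:E * ((enorm z - r) `^ (- s))%:E)%E).
      by rewrite -EFinM lee_fin mean_kernel_le.
    rewrite lee_wpmul2l ?lee_fin//.
    rewrite mulN1r [- r + _]addrC.
    have rz0 : 0 < enorm z - r by rewrite subr_gt0.
    have [t1|t1] := leP (enorm z - r) 1.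
      rewrite /psi patchT ?inE/= ?in_itv/= ?rz0//.
      by rewrite (_ : 1 - s - 1 = - s); [rewrite leeDl|ring].
    apply: (@le_trans _ _ 1%E); last by rewrite leeDr.
    by rewrite lee_fin; apply: powR_le1; [exact: ltW|rewrite oppr_le0 ltW].
rewrite ge0_integralZl//; last 2 first.
- apply: (measurable_funS measurableT) => //; exact: emeasurable_funD.
- by move=> r _; rewrite adde_ge0.
rewrite EFinM lee_wpmul2l ?lee_fin// ge0_integralD//; last exact: (measurable_funS measurableT).
rewrite EFinD; apply: leeD.
  apply: (@le_trans _ _ (\int[leb]_t psi (-1 * t + enorm z)%R)%E).
    exact: ge0_subset_integral.
  have := @ge0_integral_affine R (-1) (enorm z) psi; rewrite oppr_eq0 oner_eq0 => /(_ isT mpsi psi0).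
  by rewrite normrN1 mul1e => ->.
rewrite integral_cst//= lebesgue_measure_itv/= lte_fin ltr1n mul1e -EFinB lee_fin.
by lra.
Qed.

Lemma ge0_integral_mean_kernel (r : R) : 0 < r ->
  (\int[mu]_t (mean_kernel r (pt t))%:E =
   (r `^ (- (2 * s)))%:E * \int[mu]_t (mean_kernel 1 (pt t))%:E)%E.
Proof.
move=> r0; have ri0 : r^-1 != 0 by rewrite invr_eq0 gt_eqF.
rewrite -(@ge0_integral_pt_affine _ _ (mean_kernel 1) r^-1 0 ri0 (borel_mean_kernel 1) (mean_kernel_ge0 1)).
rewrite muleA -EFinM normrV ?unitfE ?gt_eqF// gtr0_norm// exprVn.
have -> : r `^ (- (2 * s)) * r ^- n = r `^ (- (2 * s) - n%:R).
  by rewrite powRD ?(gt_eqF r0) ?implybT// (powRN r n%:R) powR_mulrn// ltW.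
rewrite -ge0_integralZl//; last 3 first.
- by apply/measurable_EFinP; exact: (measurable_borel (borel_affine_fun r^-1 0 (borel_mean_kernel 1))).
- by move=> t _; rewrite lee_fin mean_kernel_ge0.
- by rewrite lee_fin powR_ge0.
by apply: eq_integral => t _; rewrite addr0 -EFinM -mean_kernelZ.
Qed.

(* By scaling, the integral over |y| > r is a constant times r ^ (- 2 s);
   averaging over r in [1, 2] smooths out the singularity on the sphere and
   shows that this constant is finite. *)
Lemma integrable_mean_kernel1 : rv_integrable (mean_kernel 1).
Proof.
have /andP[s0 s1] := s01.
apply/integrableP; split.
  by apply/measurable_EFinP; exact: (measurable_borel (borel_mean_kernel 1)).
under eq_integral do rewrite /= ger0_norm ?mean_kernel_ge0//.
set A := (\int[mu]_t _)%E.
have A0 : (0 <= A)%E by apply: integral_ge0 => t _; rewrite lee_fin mean_kernel_ge0.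
pose chi (r : R) : R := if 1 <= r then (if r <= 2 then 1 else 0) else 0.
have mchi : measurable_fun setT chi.
  by apply: measurable_fun_ifT => //; [exact: measurable_fun_ler|apply: measurable_fun_ifT => //; exact: measurable_fun_ler].
have chi0 r : 0 <= chi r by rewrite /chi; do 2 case: ifP => // _.
pose F (z : T * measurableTypeR R) := (chi z.2 * mean_kernel z.2 (pt z.1))%:E.
have F0 x : (0 <= F x)%E by rewrite lee_fin mulr_ge0 ?mean_kernel_ge0.
have mF : measurable_fun setT F.
  apply/measurable_EFinP; apply: measurable_funM.
    exact: (measurableT_comp mchi).
  apply: measurable_mean_kernel => // i.
  exact: (measurableT_comp (measurable_pt i)).
have chiE (f : R -> R) : (forall r, 0 <= f r) ->
    (\int[leb]_r (chi r * f r)%:E = \int[leb]_(r in `[1%R, 2%R]) (f r)%:E)%E.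
  move=> f0; rewrite [RHS]integral_mkcond; apply: eq_integral => r _.
  rewrite /chi patchE; have [|] := boolP (r \in `[1, 2]%classic).
    by rewrite inE/= in_itv/= => /andP[-> ->]; rewrite mul1r.
  rewrite notin_setE/= in_itv/= => /negP.
  by case: (1 <= r) => //=; rewrite ?mul0r//; case: (r <= 2) => //; rewrite mul0r.
have H := etrans (esym (fubini_tonelli2 (m1 := mu) (m2 := leb) F mF F0))
  (fubini_tonelli1 (m1 := mu) (m2 := leb) F mF F0).
have : (\int[leb]_r fubini_G mu F r < +oo)%E.
  rewrite H; apply: (@le_lt_trans _ _ (\int[mu]_t (((1 - s)^-1 + 1) * domin (pt t))%:E)%E); last first.
    by rewrite (rintE (rv_integrableZ _ (integrable_domin n_gt0 s01))) ltry.
  apply: ge0_le_integral => //.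
  - by move=> t _; apply: integral_ge0.
  - exact: measurable_fun_fubini_tonelli_F.
  - by have /measurable_int := rv_integrableZ ((1 - s)^-1 + 1) (integrable_domin n_gt0 s01).
  - move=> t _; rewrite /fubini_F/= chiE; last by move=> r; exact: mean_kernel_ge0.
    by apply: le_trans (integral_mean_kernel_radius (pt t)) _; rewrite mulrC.
set J := (\int[leb]_r _)%E => Jfin.
(* The least value on [1, 2] of the scaling factor [r^(-2s)]. *)
pose c : R := 2 `^ (- (2 * s)).
have c0 : 0 < c by rewrite powR_gt0.
have cA : (c%:E * A <= J)%E.
  apply: (@le_trans _ _ (\int[leb]_(r in `[1%R, 2%R]) (c%:E * A))%E).
    by rewrite integral_cst//= lebesgue_measure_itv/= lte_fin ltr1n -EFinB (_ : 2 - 1 = 1 :> R) ?mule1//; ring.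
  apply: (@le_trans _ _ (\int[leb]_(r in `[1%R, 2%R]) fubini_G mu F r)%E); last first.
    apply: ge0_subset_integral => //; first exact: measurable_fun_fubini_tonelli_G.
    by move=> r _; apply: integral_ge0.
  apply: ge0_le_integral => //.
  - by move=> r _; rewrite mule_ge0// lee_fin ltW.
  - by apply: (measurable_funS measurableT) => //; exact: measurable_fun_fubini_tonelli_G.
  - move=> r; rewrite /= in_itv/= => /andP[r1 r2].
    have r0 := lt_le_trans ltr01 r1.
    rewrite /fubini_G /F /= /chi r1 r2; under eq_integral do rewrite mul1r.
    rewrite ge0_integral_mean_kernel// -/A lee_wpmul2r// lee_fin.
    by apply: powR_le_neg => //; rewrite oppr_le0 mulr_ge0// ltW.
rewrite ltey; apply/eqP => Aoo; move: cA; rewrite Aoo gt0_muley ?lte_fin//.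
by rewrite leye_eq => /eqP Joo; move: Jfin; rewrite Joo ltxx.
Qed.

Local Notation A := (rint (mean_kernel 1)).

Lemma integrable_mean_kernel (r : R) : 0 < r -> rv_integrable (mean_kernel r).
Proof.
move=> r0; apply/integrableP; split.
  by apply/measurable_EFinP; exact: (measurable_borel (borel_mean_kernel r)).
under eq_integral do rewrite /= ger0_norm ?mean_kernel_ge0//.
by rewrite ge0_integral_mean_kernel// (rintE integrable_mean_kernel1) -EFinM ltry.
Qed.

Lemma rint_mean_kernel (r : R) : 0 < r -> rint (mean_kernel r) = r `^ (- (2 * s)) * A.
Proof.
move=> r0; have E1 := rintE integrable_mean_kernel1.
have E2 := rintE (integrable_mean_kernel r0).
apply: EFin_inj; apply: (etrans (esym E2)).
by rewrite EFinM ge0_integral_mean_kernel//; congr (_ * _)%E; exact: E1.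
Qed.

(* The first term uses [(1 - t) ^ (- s) - 1 <= t (1 - t) ^ (- s)] with [t = r ^ 2 / |z| ^ 2]. *)
Lemma mean_kernel_near r z : 0 < r -> r <= 1 ->
  `|mean_kernel r z - lap_kernel z| * min1 z ^+ 2 <=
  r `^ (1 + s) * mean_kernel r z + r `^ (1 - s) * domin z.
Proof.
move=> r0 r1; have /andP[s0 s1] := s01.
have [rz|zr] := ltP r (enorm z); last first.
  rewrite /mean_kernel (_ : (r < enorm z) = false); last by rewrite ltNge zr.
  by rewrite sub0r normrN (ger0_norm (lap_kernel_ge0 _ _)) mulr0 add0r lap_kernel_near.
have z0 := lt_trans r0 rz.
apply: (@le_trans _ _ (r `^ (1 + s) * mean_kernel r z)); last first.
  by rewrite lerDl mulr_ge0 ?powR_ge0 ?domin_ge0.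
rewrite /mean_kernel rz.
set X := enorm z ^+ 2; set Y := X - r ^+ 2.
have X0 : 0 < X by rewrite exprn_gt0.
have Y0 : 0 < Y by rewrite subr_gt0 ltrXn2r// ?nnegrE ltW.
have YX : Y <= X by rewrite lerBlDr lerDl sqr_ge0.
have lapE : lap_kernel z = X `^ (- s) * enorm z `^ (- n%:R).
  rewrite /lap_kernel opprD addrC powRD ?(gt_eqF z0) ?implybT//.
  by rewrite /X -powR_mulrn ?(ltW z0)// -powRrM mulrN.
have XY : X `^ (- s) <= Y `^ (- s) by apply: powR_le_neg => //; rewrite oppr_le0 ltW.
have key : Y `^ (- s) - X `^ (- s) <= r ^+ 2 / X * Y `^ (- s).
  have H : Y * Y `^ (- s) <= X * X `^ (- s).
    have E (W : R) : 0 < W -> W * W `^ (- s) = W `^ (1 - s).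
      by move=> W0; rewrite powRD ?(gt_eqF W0) ?implybT// powRr1// ltW.
    rewrite !E//; apply: ge0_ler_powR => //; rewrite ?nnegrE ?ltW//; lra.
  rewrite mulrAC ler_pdivlMr// mulrBl.
  have -> : r ^+ 2 = X - Y by rewrite /Y; ring.
  by rewrite mulrBl; lra.
rewrite lapE -mulrBl normrM (ger0_norm (powR_ge0 _ _)) ger0_norm ?subr_ge0//.
rewrite mulrAC [leRHS]mulrA ler_wpM2r ?powR_ge0//.
apply: le_trans (ler_wpM2r (sqr_ge0 _) key) _.
rewrite mulrAC ler_wpM2r ?powR_ge0//.
(* Since 1 + s lies between 0 and 2, this bound covers both small and large [z]. The exponent is
   chosen so that [r^(1 + s)], multiplied by the mass [r^(-2s)] of [mean_kernel], is again of order
   [r^(1 - s)]. *)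
have m2 : min1 z ^+ 2 <= enorm z `^ (1 + s).
  rewrite /min1; case: (leP 1 (enorm z)) => z1.
    by rewrite expr1n -[leLHS](powRr0 (enorm z)); apply: ler_powR => //; lra.
  rewrite -powR_mulrn ?(ltW z0)//; apply: ger_powR; rewrite ?z0 ?(ltW z1)//; lra.
apply: (@le_trans _ _ (r ^+ 2 / X * enorm z `^ (1 + s))).
  by rewrite ler_wpM2l// divr_ge0 ?sqr_ge0// ltW.
have -> : r ^+ 2 / X * enorm z `^ (1 + s) = r ^+ 2 * enorm z `^ (s - 1).
  rewrite -mulrA; congr (_ * _).
  rewrite /X -powR_mulrn ?(ltW z0)// -powRN -powRD ?(gt_eqF z0) ?implybT//.
  by congr (_ `^ _); ring.
have -> : r `^ (1 + s) = r ^+ 2 * r `^ (s - 1).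
  rewrite -powR_mulrn ?(ltW r0)// -powRD ?(gt_eqF r0) ?implybT//.
  by congr (_ `^ _); ring.
rewrite ler_wpM2l ?sqr_ge0//; apply: powR_le_neg; rewrite ?(ltW rz)//; lra.
Qed.

End MeanKernel.

(** * Weighted means of functions squeezed between two powers *)

Section PowerMean.
Context {R : realType}.
Local Notation leb := (@lebesgue_measure R).
Variables (s alpha l U R0 : R) (M : R -> R).
Hypotheses (s0 : 0 < s) (alpha0 : 0 <= alpha) (l0 : 0 <= l) (U0 : 0 <= U).
Hypothesis lU : U * (1 + s) <= l * (1 + 3 * s).
Hypothesis mM : measurable_fun setT M.
Hypothesis M_ge : forall r, 0 < r -> r < R0 -> alpha + l * r `^ (2 * s) <= M r.
Hypothesis M_le : forall r, 0 < r -> r < R0 -> M r <= alpha + U * r `^ (2 * s).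

Definition power_mean (r : R) : \bar R :=
  ((r `^ (- 1 - s))%:E * \int[leb]_(t in `]0%R, r[) (t `^ s * M t)%:E)%E.

Let f t := (t `^ s * M t)%:E.

Let mf (D : set R) : measurable_fun D f.
Proof.
apply/measurable_EFinP; apply: (measurable_funS measurableT) => //.
by apply: measurable_funM => //; exact: measurable_powR.
Qed.

Let f_ge0 t : 0 < t -> t < R0 -> (0 <= f t)%E.
Proof.
move=> t0 tR; rewrite lee_fin mulr_ge0 ?powR_ge0//; apply: le_trans (M_ge t0 tR).
by rewrite addr_ge0 ?mulr_ge0 ?powR_ge0.
Qed.

(** Integrating the upper bound of [M] yields [U / (1 + 3 s)], which [lU] replaces by [l / (1 + s)]:
    the integral up to [r] is at most that of a constant [M] equal to its lower bound at [r]. *)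
Let integral_le r : 0 < r -> r < R0 ->
  (\int[leb]_(t in `]0%R, r[) f t <=
   ((alpha + l * r `^ (2 * s)) * (r `^ (1 + s) / (1 + s)))%:E)%E.
Proof.
move=> r0 rR.
have mpow (p c : R) : measurable_fun setT (fun t : R => (c * t `^ p)%:E).
  by apply/measurable_EFinP; apply: measurable_funM => //; exact: measurable_powR.
have B (p c : R) : 0 < p -> 0 <= c ->
    (\int[leb]_(t in `]0%R, r]) (c * t `^ (p - 1))%:E <= (c * (r `^ p / p))%:E)%E.
  move=> p0 c0; under eq_integral do rewrite EFinM.
  rewrite ge0_integralZl//; last 2 first.
  - exact: measurable_powR_EFin.
  - by move=> t _; rewrite lee_fin powR_ge0.
  by rewrite EFinM lee_wpmul2l ?lee_fin// integral_powR_le.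
apply: (@le_trans _ _ (\int[leb]_(t in `]0%R, r]) ((alpha * t `^ (1 + s - 1))%:E + (U * t `^ (1 + 3 * s - 1))%:E))%E).
  apply: (@le_trans _ _ (\int[leb]_(t in `]0%R, r]) f t)%E).
    apply: ge0_subset_integral => //; first exact: mf.
      by move=> t; rewrite /= in_itv/= => /andP[t0 tr]; apply: f_ge0 => //; exact: le_lt_trans rR.
    by move=> t; rewrite /= !in_itv/= => /andP[-> /ltW].
  apply: ge0_le_integral => //; [|exact: mf| |].
  - by move=> t; rewrite /= in_itv/= => /andP[t0 tr]; apply: f_ge0 => //; exact: le_lt_trans rR.
  - by apply: emeasurable_funD; apply: (measurable_funS measurableT) => //; exact: mpow.
  - move=> t; rewrite /= in_itv/= => /andP[t0 tr].
    rewrite -EFinD lee_fin.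
    rewrite (_ : 1 + s - 1 = s); last by ring.
    rewrite (_ : t `^ (1 + 3 * s - 1) = t `^ s * t `^ (2 * s)); last first.
      by rewrite -powRD ?(gt_eqF t0) ?implybT//; congr (_ `^ _); ring.
    rewrite [leRHS](_ : _ = t `^ s * (alpha + U * t `^ (2 * s))); last by ring.
    by rewrite ler_wpM2l ?powR_ge0//; apply: M_le => //; exact: le_lt_trans rR.
rewrite ge0_integralD//; last 4 first.
- by move=> t _; rewrite lee_fin mulr_ge0 ?powR_ge0.
- by apply: (measurable_funS measurableT) => //; exact: mpow.
- by move=> t _; rewrite lee_fin mulr_ge0 ?powR_ge0.
- by apply: (measurable_funS measurableT) => //; exact: mpow.
have p1 : 0 < 1 + s by rewrite addr_gt0.
have p3 : 0 < 1 + 3 * s by rewrite addr_gt0 ?mulr_gt0.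
apply: le_trans (leeD (B _ _ p1 alpha0) (B _ _ p3 U0)) _.
rewrite -EFinD lee_fin [leRHS]mulrDl lerD2l -mulrA.
rewrite (_ : r `^ (1 + 3 * s) = r `^ (2 * s) * r `^ (1 + s)); last first.
  by rewrite -powRD ?(gt_eqF r0) ?implybT//; congr (_ `^ _); ring.
rewrite [leLHS](_ : _ = r `^ (2 * s) * r `^ (1 + s) * (U / (1 + 3 * s))); last by ring.
rewrite [leRHS](_ : _ = r `^ (2 * s) * r `^ (1 + s) * (l / (1 + s))); last by ring.
rewrite ler_wpM2l ?mulr_ge0 ?powR_ge0//.
by rewrite ler_pdivrMr// mulrAC ler_pdivlMr.
Qed.

(** The lower bound of [M] increases since [l] is nonnegative, so it may be frozen at [r1]. This is
    the constant of [integral_le] at [r1], which makes the two estimates comparable. *)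
Let integral_ge r1 r2 : 0 < r1 -> r1 <= r2 -> r2 < R0 ->
  (((alpha + l * r1 `^ (2 * s)) * ((r2 `^ (1 + s) - r1 `^ (1 + s)) / (1 + s)))%:E <=
   \int[leb]_(t in `[r1, r2[) f t)%E.
Proof.
move=> r10 r12 r2R.
set c := alpha + _.
have c0 : 0 <= c by rewrite addr_ge0 ?mulr_ge0 ?powR_ge0.
have p1 : 1 + s != 0 by rewrite gt_eqF// addr_gt0.
rewrite EFinM -(integral_powR r10 r12 p1) -integral_itv_bndo_bndc; last exact: measurable_powR_EFin.
rewrite -ge0_integralZl//; last 2 first.
- exact: measurable_powR_EFin.
- by move=> t _; rewrite lee_fin powR_ge0.
apply: ge0_le_integral => //.
- by move=> t _; rewrite -EFinM lee_fin mulr_ge0 ?powR_ge0.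
- by apply: measurable_funeM; exact: measurable_powR_EFin.
- exact: mf.
- move=> t; rewrite /= in_itv/= => /andP[tr1 tr2].
  have t0 := lt_le_trans r10 tr1; have tR := lt_trans tr2 r2R.
  rewrite -EFinM lee_fin mulrC (_ : 1 + s - 1 = s); last by ring.
  rewrite ler_wpM2l ?powR_ge0//; apply: le_trans (M_ge t0 tR).
  rewrite lerD2l ler_wpM2l//; apply: ge0_ler_powR; rewrite ?nnegrE ?(ltW r10) ?(ltW t0)//.
  by rewrite mulr_ge0// ltW.
Qed.

(* Any [M] of the form [alpha + c r ^ (2 s)] has an increasing mean; the
   inequality [lU] leaves room for perturbing the coefficient [c]. *)
Lemma power_mean_mono r1 r2 : 0 < r1 -> r1 <= r2 -> r2 < R0 ->
  (power_mean r1 <= power_mean r2)%E.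
Proof.
move=> r10 r12 r2R; have r20 := lt_le_trans r10 r12; have r1R := le_lt_trans r12 r2R.
rewrite /power_mean.
have -> : (`]0, r2[%classic : set R) = `]0, r1[ `|` `[r1, r2[.
  apply/seteqP; split=> t /=; rewrite !in_itv/=.
    by move=> /andP[t0 t2]; case: (ltP t r1) => t1; [left|right]; apply/andP.
  move=> [|] /andP[ta tb]; apply/andP; split=> //; first exact: lt_le_trans r12.
  exact: lt_le_trans ta.
rewrite ge0_integral_setU//; last 3 first.
- exact: mf.
- move=> t /=; rewrite !in_itv/= => -[|] /andP[ta tb]; apply: f_ge0 => //.
  + exact: lt_trans tb r1R.
  + exact: lt_le_trans ta.
  + exact: lt_trans tb r2R.
- apply/disj_setPS => t /=; rewrite !in_itv/= => -[/andP[_ +] /andP[+ _]].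
  by move=> /lt_le_trans H /H; rewrite ltxx.
have I1le := integral_le r10 r1R; have I2ge := integral_ge r10 r12 r2R.
have I1ge : (0 <= \int[leb]_(t in `]0%R, r1[) f t)%E.
  apply: integral_ge0 => t; rewrite /= in_itv/= => /andP[t0 tr]; apply: f_ge0 => //.
  exact: lt_trans r1R.
move: I1le I2ge I1ge.
rewrite -/f; set I1 := (\int[leb]_(t in `]0%R, r1[) f t)%E.
set I2 := (\int[leb]_(t in `[r1, r2[) f t)%E.
set c := alpha + _ => I1le I2ge I1ge.
have I1fin : I1 \is a fin_num.
  by rewrite ge0_fin_numE//; apply: le_lt_trans I1le _; rewrite ltry.
move: I1le I1ge; rewrite -(fineK I1fin) !lee_fin; move: (fine I1) => x xle x0.
have c0 : 0 <= c by rewrite addr_ge0 ?mulr_ge0 ?powR_ge0.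
apply: (@le_trans _ _ ((r2 `^ (- 1 - s))%:E * (x%:E + (c * ((r2 `^ (1 + s) - r1 `^ (1 + s)) / (1 + s)))%:E))%E); last first.
  by rewrite lee_wpmul2l ?lee_fin ?powR_ge0// leeD2l.
rewrite -EFinD -!EFinM lee_fin.
have E (r : R) : r `^ (- 1 - s) = (r `^ (1 + s))^-1 by rewrite -powRN; congr (_ `^ _); ring.
rewrite !E; set P1 := r1 `^ (1 + s) in xle *; set P2 := r2 `^ (1 + s).
have P10 : 0 < P1 by exact: powR_gt0.
have P20 : 0 < P2 by exact: powR_gt0.
have P12 : P1 <= P2.
  by apply: ge0_ler_powR => //; rewrite ?nnegrE ?addr_ge0 ?(ltW r10) ?(ltW r20) ?(ltW s0).
rewrite ler_pdivrMl// mulrCA ler_pdivlMl//.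
have s1 : 0 < 1 + s by rewrite addr_gt0.
(* With denominators cleared, what remains is [x <= c * (P1 / (1 + s))] times [P2 - P1]: the part up
   to [r1] has a mean of at most [c / (1 + s)], and the part beyond contributes at least that. *)
have H : x * (P2 - P1) <= c * (P1 / (1 + s)) * (P2 - P1) by rewrite ler_wpM2r// subr_ge0.
rewrite [leRHS](_ : _ = x * P1 + c * (P1 / (1 + s)) * (P2 - P1)); last by ring.
by rewrite -lerBlDl (_ : P2 * x - x * P1 = x * (P2 - P1))//; ring.
Qed.

End PowerMean.

(** * Expansion of the mean at small radii *)

Section MeanExpansion.
Context {R : realType} {n : nat}.
Variables (s : R) (g : 'I_n -> 'rV[R]_n -> R) (C : R).
Hypotheses (n_gt0 : (0 < n)%N) (s01 : 0 < s < 1).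
Hypotheses (C_ge0 : 0 <= C) (borel_g : forall i, borel_fun (g i))
  (gC : forall i l x, (size l <= 2)%N -> `|diffs l (g i) x| <= C * \prod_(a <- l) min1 a).
Local Notation domin := (@domin R n s).
Local Notation lap_kernel := (@lap_kernel R n s).
Local Notation mean_kernel := (@mean_kernel R n s).
Local Notation mu := (lm_mu (@lebesgue_model R n)).
Local Notation A := (rint (mean_kernel 1)).
Local Notation Dom := (rint domin).
Implicit Types (z : 'rV[R]_n) (i : 'I_n).

Definition sq_norm z : R := \sum_i g i z ^+ 2.

(* Averaging over [z] and [- z] makes the deviation from the value at 0 quadratically small. *)
Definition sym_dev z : R := 2^-1 * (sq_norm z + sq_norm (- z)) - sq_norm 0.

(** [|G z - G 0|^2] for the field [G] with components [g i], averaged over [z] and [- z]: the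
    nonnegative part of [sym_dev]. *)
Definition sq_incr z : R :=
  \sum_i (2^-1 * (diffs [:: z] (g i) 0 ^+ 2 + diffs [:: - z] (g i) 0 ^+ 2)).

Lemma borel_sq_norm : borel_fun sq_norm.
Proof. by apply: borel_sum => i d S c mc; apply: measurable_funX; exact: borel_g. Qed.

Lemma borel_sym_dev : borel_fun sym_dev.
Proof.
apply: borelB (borel_cst _).
exact: (borelZ _ (borelD borel_sq_norm (borelN borel_sq_norm))).
Qed.

(* |G z|^2 - |G 0|^2 = 2 <G 0, G z - G 0> + |G z - G 0|^2, averaged over z and - z. *)
Lemma sym_dev_decomp z :
  sym_dev z = \sum_i g i 0 * diffs [:: z; z] (g i) (- z) + sq_incr z.
Proof.
rewrite /sym_dev /sq_incr /sq_norm -!big_split /= mulr_sumr -sumrB; apply: eq_bigr => i _.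
rewrite /diff !addNr !add0r; move: (g i z) (g i (- z)) (g i 0) => a b c.
by field.
Qed.

Lemma sq_incr_ge0 z : 0 <= sq_incr z.
Proof. by apply: sumr_ge0 => i _; rewrite mulr_ge0 ?invr_ge0// addr_ge0 ?sqr_ge0. Qed.

Lemma second_diff_le i z : `|diffs [:: z; z] (g i) (- z)| <= C * min1 z ^+ 2.
Proof. by have := @gC i [:: z; z] (- z) isT; rewrite !big_cons big_nil mulr1. Qed.

Lemma sq_incr_le z : sq_incr z <= (\sum_(i < n) C ^+ 2) * min1 z ^+ 2.
Proof.
rewrite mulr_suml; apply: ler_sum => i _.
have H (a : 'rV[R]_n) : diffs [:: a] (g i) 0 ^+ 2 <= C ^+ 2 * min1 a ^+ 2.
  have := @gC i [:: a] 0 isT; rewrite big_cons big_nil mulr1 => H.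
  by rewrite -real_normK ?num_real// -exprMn lerXn2r ?nnegrE ?mulr_ge0 ?min1_ge0.
move: (H z) (H (- z)); rewrite min1N.
move: (_ ^+ 2) (_ ^+ 2) (_ * _) => a b c ac bc.
by rewrite ler_pdivrMl// mulr_natl mulr2n lerD.
Qed.

(** [|g i 0| * C] comes from the second differences in [sym_dev_decomp], and [C ^+ 2] from the
    squared increments. *)
Definition dev_bound : R := \sum_(i < n) (`|g i 0| * C + C ^+ 2).

Lemma dev_bound_ge0 : 0 <= dev_bound.
Proof. by apply: sumr_ge0 => i _; rewrite addr_ge0 ?mulr_ge0 ?exprn_ge0. Qed.

Lemma sym_dev_le z : `|sym_dev z| <= dev_bound * min1 z ^+ 2.
Proof.
rewrite sym_dev_decomp; apply: le_trans (ler_normD _ _) _.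
rewrite /dev_bound big_split/= mulrDl; apply: lerD; last first.
  by rewrite (ger0_norm (sq_incr_ge0 z)); exact: sq_incr_le.
rewrite mulr_suml; apply: le_trans (ler_norm_sum _ _ _) _; apply: ler_sum => i _.
by rewrite normrM -mulrA ler_wpM2l//; exact: second_diff_le.
Qed.

Lemma borel_second_diff i : borel_fun (fun z => diffs [:: z; z] (g i) (- z)).
Proof.
rewrite (_ : (fun _ => _) = fun z => (g i z + g i (- z)) - 2 * g i 0); last first.
  by apply/funext => z; rewrite /= /diff !addNr !add0r; ring.
exact: (borelB (borelD (borel_g i) (borelN (borel_g i))) (borel_cst _)).
Qed.

Lemma borel_sq_incr : borel_fun sq_incr.
Proof.
rewrite (_ : sq_incr = fun z => sym_dev z - \sum_i g i 0 * diffs [:: z; z] (g i) (- z)); last first.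
  by apply/funext => z; rewrite sym_dev_decomp [X in X - _]addrC addrK.
apply: (borelB borel_sym_dev); apply: borel_sum => i.
exact: (borelZ _ (borel_second_diff i)).
Qed.

Lemma integrable_lap_kernel (h : 'rV[R]_n -> R) (B : R) : borel_fun h -> 0 <= B ->
  (forall z, `|h z| <= B * min1 z ^+ 2) -> rv_integrable (fun z => lap_kernel z * h z).
Proof.
move=> bh B0 hB; apply: (rv_integrable_dom (C := B) n_gt0 s01).
  exact: (borelM (borel_lap_kernel s) bh).
move=> z; rewrite normrM (ger0_norm (lap_kernel_ge0 _ _)).
apply: le_trans (ler_wpM2l (lap_kernel_ge0 _ _) (hB z)) _.
by rewrite mulrCA ler_wpM2l// lap_kernel_le.
Qed.

(** The coefficient N of the overview: up to the factor [- Cns n s], the fractional Laplacian of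
    [|G|^2] at the origin. *)
Definition dev_lap : R := rint (fun z => lap_kernel z * sym_dev z).

Lemma integrable_dev_lap : rv_integrable (fun z => lap_kernel z * sym_dev z).
Proof. exact: (integrable_lap_kernel borel_sym_dev dev_bound_ge0 sym_dev_le). Qed.

Lemma integrable_sq_incr : rv_integrable (fun z => lap_kernel z * sq_incr z).
Proof.
apply: (integrable_lap_kernel (B := \sum_(i < n) C ^+ 2) borel_sq_incr).
  by apply: sumr_ge0 => i _; rewrite sqr_ge0.
by move=> z; rewrite (ger0_norm (sq_incr_ge0 z)); exact: sq_incr_le.
Qed.

Lemma integrable_second_diff i :
  rv_integrable (fun z => lap_kernel z * diffs [:: z; z] (g i) (- z)).
Proof. exact: (integrable_lap_kernel (borel_second_diff i) C_ge0 (second_diff_le i)). Qed.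

Lemma dev_lap_decomp : dev_lap =
  \sum_i g i 0 * rint (fun z => lap_kernel z * diffs [:: z; z] (g i) (- z)) +
  rint (fun z => lap_kernel z * sq_incr z).
Proof.
transitivity (rint (fun z => \sum_i g i 0 * (lap_kernel z * diffs [:: z; z] (g i) (- z)) +
    lap_kernel z * sq_incr z)).
  apply: eq_rint => z; rewrite sym_dev_decomp mulrDr mulr_sumr; congr (_ + _).
  by apply: eq_bigr => i _; rewrite mulrCA.
have I i := rv_integrableZ (g i 0) (integrable_second_diff i).
rewrite rintD; [|exact: rv_integrable_sum|exact: integrable_sq_incr].
congr (_ + _); rewrite rint_sum//.
by apply: eq_bigr => i _; rewrite (rintZ _ (integrable_second_diff i)).
Qed.

Lemma mean_kernel_bounded_integrable (h : 'rV[R]_n -> R) (B r : R) : 0 < r -> borel_fun h ->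
  (forall z, `|h z| <= B) -> rv_integrable (fun z => mean_kernel r z * h z).
Proof.
move=> r0 bh hB; have bq := borelM (borel_mean_kernel s r) bh.
apply: (rv_integrable_le bq (rv_integrableZ B (integrable_mean_kernel n_gt0 s01 r0))).
by move=> z; rewrite normrM (ger0_norm (mean_kernel_ge0 _ _ _)) mulrC ler_wpM2r ?mean_kernel_ge0.
Qed.

Lemma sq_norm_le z : `|sq_norm z| <= \sum_(i < n) C ^+ 2.
Proof.
rewrite ger0_norm; last by apply: sumr_ge0 => i _; rewrite sqr_ge0.
apply: ler_sum => i _; rewrite -real_normK ?num_real// lerXn2r ?nnegrE//.
by have := @gC i [::] z isT; rewrite big_nil mulr1.
Qed.

Lemma integrable_mean_sq_norm r : 0 < r -> rv_integrable (fun z => mean_kernel r z * sq_norm z).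
Proof. by move=> r0; exact: (mean_kernel_bounded_integrable r0 borel_sq_norm sq_norm_le). Qed.

Lemma integrable_mean_sym_dev r : 0 < r -> rv_integrable (fun z => mean_kernel r z * sym_dev z).
Proof.
move=> r0; apply: (mean_kernel_bounded_integrable (B := dev_bound) r0 borel_sym_dev) => z.
apply: le_trans (sym_dev_le z) _; rewrite ler_piMr ?dev_bound_ge0//.
rewrite expr_le1 ?min1_ge0//; by rewrite /min1 ge_min lexx.
Qed.

(** The kernel is even, so [sq_norm] may be averaged over [z] and [- z]; its value at 0 is then
    split off and integrated by scaling. *)
Lemma rint_mean_sq_norm r : 0 < r ->
  rint (fun z => mean_kernel r z * sq_norm z) =
  r `^ (- (2 * s)) * (A * sq_norm 0) + rint (fun z => mean_kernel r z * sym_dev z).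
Proof.
move=> r0; have iv := integrable_mean_sq_norm r0.
have bv := borelM (borel_mean_kernel s r) borel_sq_norm.
have ivN : rv_integrable (fun z => mean_kernel r (-1 *: z + 0) * sq_norm (-1 *: z + 0)).
  by apply: (integrable_pt_affine1 _ _ bv iv); rewrite normrN1.
have EN : rint (fun z => mean_kernel r (-1 *: z + 0) * sq_norm (-1 *: z + 0)) =
    rint (fun z => mean_kernel r z * sq_norm z).
  by apply: (rint_affine1 _ _ bv); rewrite normrN1.
have iw := integrable_mean_sym_dev r0; have iq := integrable_mean_kernel n_gt0 s01 r0.
have E z : 2 * (mean_kernel r z * sym_dev z) + 2 * sq_norm 0 * mean_kernel r z =
    mean_kernel r z * sq_norm z + mean_kernel r (-1 *: z + 0) * sq_norm (-1 *: z + 0).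
  rewrite scaleN1r addr0 mean_kernelN /sym_dev.
  by move: (mean_kernel r z) (sq_norm z) (sq_norm (- z)) (sq_norm 0) => a b c d; field.
have := eq_rint E.
rewrite (rintD (rv_integrableZ _ iw) (rv_integrableZ _ iq)) (rintD iv ivN) EN.
rewrite (rintZ _ iw) (rintZ _ iq) rint_mean_kernel//.
move: (rint _) (rint _) (rint _) (_ `^ _) (sq_norm 0) => a b c d e; lra.
Qed.

(** Integrates [mean_kernel_near]. The mass [r^(-2s) A] of the kernel turns [r^(1 + s)] into
    [r^(1 - s)], so both errors have the same order. *)
Lemma rint_mean_sym_dev_near r : 0 < r -> r <= 1 ->
  `|rint (fun z => mean_kernel r z * sym_dev z) - dev_lap| <=
  dev_bound * (A + Dom) * r `^ (1 - s).
Proof.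
move=> r0 r1; have /andP[s0 s1] := s01.
have iw := integrable_mean_sym_dev r0; have iq := integrable_mean_kernel n_gt0 s01 r0.
have iD := integrable_domin n_gt0 s01.
rewrite /dev_lap -(rintB iw integrable_dev_lap).
have iB : rv_integrable (fun z => dev_bound * (r `^ (1 + s) * mean_kernel r z + r `^ (1 - s) * domin z)).
  exact: (rv_integrableZ _ (rv_integrableD (rv_integrableZ _ iq) (rv_integrableZ _ iD))).
apply: (@le_trans _ _ (rint (fun z => dev_bound * (r `^ (1 + s) * mean_kernel r z + r `^ (1 - s) * domin z)))).
  apply: (rint_norm_le (rv_integrableB iw integrable_dev_lap) iB) => z.
  rewrite -mulrBl normrM; apply: le_trans (ler_wpM2l (normr_ge0 _) (sym_dev_le z)) _.
  by rewrite mulrCA ler_wpM2l ?dev_bound_ge0// mean_kernel_near.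
rewrite (rintZ _ (rv_integrableD (rv_integrableZ _ iq) (rv_integrableZ _ iD))).
rewrite (rintD (rv_integrableZ _ iq) (rv_integrableZ _ iD)) (rintZ _ iq) (rintZ _ iD).
rewrite rint_mean_kernel// mulrA -powRD ?(gt_eqF r0) ?implybT//.
rewrite (_ : 1 + s - 2 * s = 1 - s); last by ring.
by rewrite -mulrDr -mulrA [(_ + _) * _]mulrC.
Qed.

Hypothesis cross : 0 <= \sum_i g i 0 * rint (fun z => lap_kernel z * diffs [:: z; z] (g i) (- z)).

Lemma dev_lap_ge0 : 0 <= dev_lap.
Proof.
rewrite dev_lap_decomp addr_ge0// rint_ge0// => z.
by rewrite mulr_ge0 ?lap_kernel_ge0 ?sq_incr_ge0.
Qed.

(* If [dev_lap = 0] then the increments of [g] vanish a.e., hence so does [sym_dev]. *)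
Lemma dev_lap_eq0 r : dev_lap = 0 -> 0 < r ->
  rint (fun z => mean_kernel r z * sym_dev z) = 0.
Proof.
move=> N0 r0.
(* [dev_lap] is [cross] plus this integral, both nonnegative, so each vanishes. *)
have I0 : rint (fun z => lap_kernel z * sq_incr z) = 0.
  apply/eqP; rewrite eq_le; apply/andP; split.
    by move: N0; rewrite dev_lap_decomp => <-; rewrite lerDr.
  by apply: rint_ge0 => z; rewrite mulr_ge0 ?lap_kernel_ge0 ?sq_incr_ge0.
have bI := borelM (borel_lap_kernel s) borel_sq_incr.
have /(ae_eq_integral_abs mu measurableT) :
    measurable_fun setT (fun t => (lap_kernel (pt t) * sq_incr (pt t))%:E).
  by apply/measurable_EFinP; exact: (measurable_borel bI).
move=> [H _]; have {}H : ae_eq mu setT (fun t => (lap_kernel (pt t) * sq_incr (pt t))%:E) (cst 0%E).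
  apply: H; under eq_integral do rewrite /= ger0_norm ?mulr_ge0 ?lap_kernel_ge0 ?sq_incr_ge0//.
  by apply: etrans (rintE integrable_sq_incr) _; rewrite I0.
rewrite /rint /Rintegral (@ae_eq_integral _ _ _ _ _ (cst 0%E))//.
- by rewrite integral0.
- by apply/measurable_EFinP; exact: (measurable_borel (borelM (borel_mean_kernel s r) borel_sym_dev)).
apply: filterS H => t /(_ I) /= [H] _; congr EFin.
(* In the closed ball of radius [r] the mean kernel vanishes. Outside it [lap_kernel] is positive,
   so [sq_incr] is 0, and with it both increments and the second difference of every [g i]. *)
have [p0|p0] := ltP r (enorm (pt t)); last first.
  by rewrite /mean_kernel (_ : (r < _) = false) ?mul0r// ltNge p0.
have {}p0 : 0 < lap_kernel (pt t) by rewrite powR_gt0// (lt_trans r0 p0).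
have {}H : sq_incr (pt t) = 0.
  by apply/eqP; move/eqP: H; rewrite mulf_eq0 (gt_eqF p0).
rewrite sym_dev_decomp H addr0.
have H0 i : diffs [:: pt t; pt t] (g i) (- pt t) = 0.
  have T0 j : 0 <= 2^-1 * (diffs [:: pt t] (g j) 0 ^+ 2 + diffs [:: - pt t] (g j) 0 ^+ 2).
    by rewrite mulr_ge0 ?invr_ge0// addr_ge0 ?sqr_ge0.
  have /eqP := H; rewrite /sq_incr psumr_eq0// => /allP /(_ i (mem_index_enum i)).
  rewrite mulf_eq0 invr_eq0 pnatr_eq0/= paddr_eq0 ?sqr_ge0// !sqrf_eq0 => /andP[/eqP E1 /eqP E2].
  move: E1 E2; rewrite /= /diff !addNr !add0r.
  by move: (g i (pt t)) (g i (- pt t)) (g i 0) => a b c /subr0_eq -> /subr0_eq ->; ring.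
by rewrite big1 ?mulr0// => i _; rewrite H0 mulr0.
Qed.

(* The mean is [A |G 0|^2 + (dev_lap + o(1)) r ^ (2 s)], where [dev_lap = 0] only
   if the mean is constant. *)
Lemma mean_expansion : exists l U R0 : R, [/\ 0 <= l, 0 <= U, U * (1 + s) <= l * (1 + 3 * s),
  0 < R0 & forall r, 0 < r -> r < R0 ->
    A * sq_norm 0 + l * r `^ (2 * s) <= r `^ (2 * s) * rint (fun z => mean_kernel r z * sq_norm z)
    /\ r `^ (2 * s) * rint (fun z => mean_kernel r z * sq_norm z) <= A * sq_norm 0 + U * r `^ (2 * s)].
Proof.
have /andP[s0 s1] := s01.
have E r : 0 < r -> r `^ (2 * s) * rint (fun z => mean_kernel r z * sq_norm z) =
    A * sq_norm 0 + rint (fun z => mean_kernel r z * sym_dev z) * r `^ (2 * s).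
  move=> r0; rewrite rint_mean_sq_norm// mulrDr mulrA -powRD ?(gt_eqF r0) ?implybT//.
  by rewrite subrr powRr0 mul1r [X in _ + X]mulrC.
have := dev_lap_ge0; rewrite le_eqVlt => /orP[/eqP N0|N0].
  exists 0, 0, 1; split; rewrite ?mul0r//.
  by move=> r r0 _; rewrite E// dev_lap_eq0// !mul0r.
have A0 : 0 <= A by apply: rint_ge0 => z; exact: mean_kernel_ge0.
have D0 : 0 <= Dom by apply: rint_ge0 => z; exact: domin_ge0.
pose B := dev_bound * (A + Dom) + 1.
have B0 : 0 < B by rewrite ltr_wpDl// mulr_ge0 ?dev_bound_ge0// addr_ge0.
(* [e] solves [(dev_lap + e) (1 + s) = (dev_lap - e) (1 + 3 s)]: the largest error for which the two
   bounds still satisfy the inequality of [power_mean_mono]. *)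
pose e := dev_lap * s / (1 + 2 * s).
have e0 : 0 < e by rewrite /e divr_gt0 ?mulr_gt0// addr_gt0 ?mulr_gt0.
have eE : e * (1 + 2 * s) = dev_lap * s by rewrite /e divfK// gt_eqF// addr_gt0 ?mulr_gt0.
have e_le : e <= dev_lap.
  by rewrite /e ler_pdivrMr ?addr_gt0 ?mulr_gt0// ler_wpM2l ?(ltW N0)//; lra.
(* The radius makes the error [B * r^(1 - s)] at most [e]; the [+ 1] in [B] keeps it positive. *)
exists (dev_lap - e), (dev_lap + e), (Num.min 1 ((e / B) `^ (1 - s)^-1)).
have R00 : 0 < (e / B) `^ (1 - s)^-1 by rewrite powR_gt0// divr_gt0.
split.
- by rewrite subr_ge0.
- by rewrite addr_ge0 ?(ltW N0) ?(ltW e0).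
- by move: (e) (dev_lap) eE => e' N eE'; nra.
- by rewrite lt_min ltr01.
move=> r r0; rewrite lt_min => /andP[/ltW r1 rR].
have H := rint_mean_sym_dev_near r0 r1.
have {}H : `|rint (fun z => mean_kernel r z * sym_dev z) - dev_lap| <= e.
  apply: le_trans H _; apply: (@le_trans _ _ (B * r `^ (1 - s))).
    by rewrite ler_wpM2r ?powR_ge0// /B lerDl.
  rewrite mulrC -ler_pdivlMr//.
  have -> : e / B = ((e / B) `^ (1 - s)^-1) `^ (1 - s).
    by rewrite -powRrM mulVf ?powRr1// ?(ltW (divr_gt0 e0 B0))// subr_eq0 gt_eqF.
  by apply: ge0_ler_powR; rewrite ?nnegrE ?subr_ge0 ?(ltW r0) ?(ltW R00) ?(ltW rR) ?(ltW s1).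
rewrite E//; move: H; rewrite ler_norml => /andP[H1 H2].
by split; rewrite lerD2l ler_wpM2r ?powR_ge0//; move: (rint _) (e) (dev_lap) H1 H2 => X e' N; lra.
Qed.

End MeanExpansion.

(** * Monotonicity of the functional *)

Section Monotonicity.
Context {R : realType} {n : nat}.
Variable s : R.
Hypotheses (n_gt0 : (0 < n)%N) (s01 : 0 < s < 1).
Local Notation leb := (@lebesgue_measure R).
Local Notation T := (lm_T (@lebesgue_model R n)).
Local Notation mu := (lm_mu (@lebesgue_model R n)).
Local Notation mean_kernel := (@mean_kernel R n s).

Lemma Gamma_ge0 (z : R) : 0 <= Gamma z.
Proof.
apply: fine_ge0; apply: integral_ge0 => t _.
by rewrite lee_fin mulr_ge0 ?powR_ge0 ?expR_ge0.
Qed.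

Lemma a_ns_ge0 : 0 <= a_ns n s.
Proof.
have /andP[s0 s1] := s01.
rewrite !mulr_ge0 ?Gamma_ge0 ?powR_ge0// sin_ge0_pi//.
by rewrite mulr_ge0 ?pi_ge0 ?(ltW s0)//= ler_piMr ?pi_ge0 ?(ltW s1).
Qed.

Lemma KernelE (r : R) y : 0 < r -> r < enorm y ->
  Defs.Kernel s r y = a_ns n s * r `^ (2 * s) * mean_kernel r y.
Proof.
move=> r0 ry; have y0 := lt_trans r0 ry.
have q0 : 0 < enorm y ^+ 2 - r ^+ 2 by rewrite subr_gt0 ltrXn2r ?nnegrE ?(ltW r0) ?(ltW y0).
rewrite /Defs.Kernel /mean_kernel ry powRM ?sqr_ge0 ?invr_ge0 ?(ltW q0)//.
rewrite (powRN (enorm y)) powR_mulrn ?(ltW y0)// -powR_inv1 ?(ltW q0)// -powRrM mulN1r.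
by rewrite -(powR_mulrn 2 (ltW r0)) -powRrM !mulrA.
Qed.

Lemma intRn_Kernel (v : 'rV[R]_n -> R) (r : R) : 0 < r -> borel_fun v -> (forall y, 0 <= v y) ->
  rv_integrable (fun y => mean_kernel r y * v y) ->
  intRn (fun y => if r < enorm y then (Defs.Kernel s r y * v y)%:E else 0%E) =
  (a_ns n s * (r `^ (2 * s) * rint (fun y => mean_kernel r y * v y)))%:E.
Proof.
move=> r0 bv v0 iv.
have bm := borelM (borel_mean_kernel s r) bv.
rewrite (_ : (fun y => _) = fun y => (a_ns n s * r `^ (2 * s) * (mean_kernel r y * v y))%:E); last first.
  apply/funext => y; case: ifP => ry; first by rewrite KernelE// !mulrA.
  by rewrite /mean_kernel ry mul0r mulr0.
rewrite intRn_ge0; last 2 first.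
- exact: (borelZ _ bm).
- by move=> y; exact: mulr_ge0 (mulr_ge0 a_ns_ge0 (powR_ge0 _ _)) (mulr_ge0 (mean_kernel_ge0 _ _ _) (v0 _)).
by rewrite (rintE (rv_integrableZ _ iv)) rintZ// mulrA.
Qed.

Lemma measurable_mean (v : 'rV[R]_n -> R) : borel_fun v ->
  measurable_fun setT (fun r => rint (fun y => mean_kernel r y * v y)).
Proof.
move=> bv.
have mI : measurable_fun setT (fun r => \int[mu]_t (mean_kernel r (pt t) * v (pt t))%:E)%E.
  apply: (@measurable_integral_param R _ _ (measurableTypeR R) T mu
    (fun r t => (mean_kernel r (pt t) * v (pt t))%:E)).
  apply/measurable_EFinP; apply: measurable_funM.
    apply: (measurable_mean_kernel (rho := fst) s _ (c := fun z : measurableTypeR R * T => pt z.2)) => // i.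
    exact: (measurableT_comp (measurable_pt i)).
  exact: (measurableT_comp (measurable_borel bv)).
exact: (measurableT_comp (@fine_measurable R setT measurableT) mI).
Qed.

(** The hypothesis at the origin amounts to the condition [cross], and [J_ACF] is a [power_mean].
    The factor [a_ns] multiplies [alpha], [l] and [U] alike, so the inequality between [l] and [U]
    survives. *)
Lemma J_ACF_mono (u : 'rV[R]_n -> R) : smooth_compact u ->
  edot (frac_grad s u 0) (frac_grad s (frac_lap s u) 0) <= 0 ->
  exists R0 : R, 0 < R0 /\ forall R1 R2 : R, 0 < R1 -> R1 <= R2 -> R2 < R0 ->
    (J_ACF s u R1 <= J_ACF s u R2)%E.
Proof.
move=> su; have cu : continuous u by have [/(_ 0%N) [_ /(_ [::] isT)]] := su.
have [K K0 uK] := diffs_bound_upto3 (smooth_compact_bounded su).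
have gE i : frac_partial s u i = fun x => mu_ns n s * riesz_grad s u i x.
  by apply/funext => x; exact: (frac_partialE n_gt0 s01 cu K0 uK).
have gD i l x : diffs l (frac_partial s u i) x = mu_ns n s * diffs l (riesz_grad s u i) x.
  by rewrite gE diffsZ.
have lapE i := frac_partial_frac_lap n_gt0 s01 cu K0 uK i.
have D0 : 0 <= K * rint (@domin R n s) by rewrite mulr_ge0// rint_ge0// => z; exact: domin_ge0.
have bG i : borel_fun (riesz_grad s u i) := borel_riesz_grad s cu i.
have GD i l x : (size l <= 2)%N ->
    `|diffs l (riesz_grad s u i) x| <= K * rint (@domin R n s) * \prod_(a <- l) min1 a.
  by move=> l2; rewrite mulrAC; exact: (riesz_grad_le n_gt0 s01 cu K0 uK).
have iG i := integrable_second_diff n_gt0 s01 D0 bG GD i.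
have bg i : borel_fun (frac_partial s u i) by rewrite gE; exact: (borelZ _ (bG i)).
have C0 : 0 <= `|mu_ns n s| * (K * rint (@domin R n s)) by rewrite mulr_ge0.
have gC i l x : (size l <= 2)%N -> `|diffs l (frac_partial s u i) x| <=
    `|mu_ns n s| * (K * rint (@domin R n s)) * \prod_(a <- l) min1 a.
  by move=> l2; rewrite gD normrM -mulrA ler_wpM2l// GD.
have second_diffE i : rint (fun z => lap_kernel s z * diffs [:: z; z] (frac_partial s u i) (- z)) =
    mu_ns n s * rint (fun z => lap_kernel s z * diffs [:: z; z] (riesz_grad s u i) (- z)).
  by rewrite -(rintZ _ (iG i)); apply: eq_rint => z; rewrite gD mulrCA.
(* One factor [mu_ns] turns [riesz_grad] into [frac_partial]. What stays in front is
   [- (Cns n s / 2)], which is negative, so the hypothesis becomes the lower bound on [cross]. *)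
have edotE : edot (frac_grad s u 0) (frac_grad s (frac_lap s u) 0) = - (Cns n s / 2) *
    \sum_i frac_partial s u i 0 *
      rint (fun z => lap_kernel s z * diffs [:: z; z] (frac_partial s u i) (- z)).
  rewrite /edot mulr_sumr; apply: eq_bigr => i _; rewrite !mxE lapE second_diffE.
  by move: (mu_ns n s) (frac_partial s u i 0) (rint _) (Cns n s) => m a b c; field.
have Cp : 0 < Cns n s / 2 by rewrite divr_gt0// Cns_gt0.
rewrite edotE mulNr oppr_le0 pmulr_rge0// => cross.
have [l [U [R0 [l0 U0 lU R00 H]]]] := mean_expansion n_gt0 s01 C0 bg gC cross.
have a0 := a_ns_ge0.
have A0 : 0 <= rint (mean_kernel 1) by apply: rint_ge0 => z; exact: mean_kernel_ge0.
have v0 y : 0 <= sq_norm (frac_partial s u) y by apply: sumr_ge0 => i _; rewrite sqr_ge0.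
have iv := integrable_mean_sq_norm n_gt0 s01 C0 bg gC.
pose m r := a_ns n s * (r `^ (2 * s) * rint (fun y => mean_kernel r y * sq_norm (frac_partial s u) y)).
have JE r : J_ACF s u r = power_mean s m r.
  rewrite /J_ACF /power_mean; congr (_ * _)%E; apply: eq_integral => t.
  rewrite inE/= in_itv/= => /andP[t0 _].
  rewrite EFinM; congr (_ * _)%E.
  rewrite -(intRn_Kernel t0 (borel_sq_norm bg) v0 (iv _ t0)).
  congr intRn; apply/funext => y; case: ifP => // _.
  by rewrite sqr_enorm; congr (_ * _)%:E; apply: eq_bigr => i _; rewrite mxE.
have mm : measurable_fun setT m.
  apply: measurable_funM => //; apply: measurable_funM; first exact: measurable_powR.
  exact: (measurable_mean (borel_sq_norm bg)).
exists R0; split=> // R1 R2 R10 R12 R2R; rewrite !JE.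
have s0 : 0 < s by have /andP[] := s01.
apply: (@power_mean_mono _ s (a_ns n s * (rint (mean_kernel 1) * sq_norm (frac_partial s u) 0))
  (a_ns n s * l) (a_ns n s * U) R0) => //.
- exact: mulr_ge0 a0 (mulr_ge0 A0 (v0 _)).
- exact: mulr_ge0 a0 l0.
- exact: mulr_ge0 a0 U0.
- by rewrite -(mulrA _ U) -(mulrA _ l) ler_wpM2l.
- by move=> r r0 rR; rewrite -(mulrA _ l) -mulrDr ler_wpM2l//; have [] := H r r0 rR.
- by move=> r r0 rR; rewrite -(mulrA _ U) -mulrDr ler_wpM2l//; have [] := H r r0 rR.
Qed.

End Monotonicity.

Theorem theorem1p6 (R : realType) (n : nat) (s eps : R)
    (u f : 'rV[R]_n -> R) :
  (0 < n)%N -> 0 < s < 1 -> 0 < eps ->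
  smooth_compact u ->
  (forall x, frac_lap s u x = f x) ->
  Holder_loc (s + eps) f ->
  L1_weighted (s / 2) f ->
  (exists delta : R, 0 < delta /\ forall x, enorm x < delta ->
     edot (frac_grad s u x) (frac_grad s f x) <= 0) ->
  exists R0 : R, 0 < R0 /\
    forall R1 R2 : R, 0 < R1 -> R1 <= R2 -> R2 < R0 ->
      (J_ACF s u R1 <= J_ACF s u R2)%E.
Proof.
move=> n_gt0 s01 _ su /funext <- _ _ [d [d0 H]].
by apply: (J_ACF_mono n_gt0 s01 su); apply: H; rewrite enorm0.
Qed.
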